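(* There exists an absolute constant $C>0$ such that the following holds for all integers $d\ge 1$, $s\in\{1,\dots,d\}$, all $\sigma>0$, every $\boldsymbol{\theta}\in B_0(s,d)$ and every covariance matrix $\boldsymbol{\Sigma}$ satisfying Assumption $(\varepsilon^*0)$: \[ \mathbf{E}_{\boldsymbol\theta,\boldsymbol\Sigma}[(\hat Q-\|\boldsymbol\theta\|_2^2)^2]\le C\left(\sigma^2\|\boldsymbol\theta\|_2^2\,\lambda_{\max}(\boldsymbol\Sigma_{\mathcal S,\mathcal S})+\sigma^4\psi^2(s,\boldsymbol\Sigma)\right), \] where $\mathcal S=\{i:\theta_i\neq 0\}$ is the support of $\boldsymbol\theta$. Furthermore, for every $r>0$ and every $\boldsymbol\Sigma$ satisfying Assumption $(\varepsilon^*0)$, \[ \sup_{\boldsymbol\theta\in B_0(s,d)\cap B_2(r)}\mathbf{E}_{\boldsymbol\theta,\boldsymbol\Sigma}[(\hat Q-\|\boldsymbol\theta\|_2^2)^2]\le C\left(\sigma^2 r^2\bar\psi(s,\boldsymbol\Sigma)+\sigma^4\psi^2(s,\boldsymbol\Sigma)\right) \] and \[ \sup_{\boldsymbol\theta\in B_0(s,d)}\mathbf{E}_{\boldsymbol\theta,\boldsymbol\Sigma}[(\hat N-\|\boldsymbol\theta\|_2)^2]\le C\sigma^2\psi(s,\boldsymbol\Sigma). \]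
   Context: Model: one observes $\boldsymbol Y=(Y_1,\dots,Y_d)=\boldsymbol\theta+\sigma\boldsymbol\varepsilon$, where $\boldsymbol\theta\in\mathbb R^d$ is unknown, $\boldsymbol\varepsilon\sim\mathcal N(\boldsymbol 0,\boldsymbol\Sigma)$ with $\boldsymbol\Sigma$ a $d\times d$ covariance matrix, and the noise level $\sigma>0$ is known. $\mathbf P_{\boldsymbol\theta,\boldsymbol\Sigma}$, $\mathbf E_{\boldsymbol\theta,\boldsymbol\Sigma}$ denote probability and expectation under this model. The diagonal entries $\sigma_i^2=\boldsymbol\Sigma_{ii}$ are known; the off-diagonal entries are not used. $B_0(s,d)=\{\boldsymbol\theta\in\mathbb R^d:\|\boldsymbol\theta\|_0\le s\}$ ($\|\cdot\|_0$ = number of nonzero entries), $B_2(r)=\{x\in\mathbb R^d:\|x\|_2\le r\}$. Assumption $(\varepsilon^*0)$: $\max_{1\le i\le d}\sigma_i^2\le 1$. $\|\boldsymbol\Sigma\|_F$ is the Frobenius norm, $\lambda_{\max}$ the largest eigenvalue, $\boldsymbol\Sigma_{\mathcal S,\mathcal S}$ the principal submatrix with rows and columns in $\mathcal S$. Let $\tau=3\sqrt{\log(1+\|\boldsymbol\Sigma\|_F^2/s^2)}$ and $\beta_s=\mathbf E[Z^2\mid |Z|\ge\tau]$ for $Z\sim\mathcal N(0,1)$. The estimator is \[ \hat Q=\begin{cases}\sum_{i=1}^d(Y_i^2-\sigma^2\sigma_i^2\beta_s)\mathbb 1\{|Y_i|>\sigma\sigma_i\tau\}, & s\le\|\boldsymbol\Sigma\|_F,\\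 \sum_{i=1}^d(Y_i^2-\sigma^2\sigma_i^2), &\text{otherwise},\end{cases}\qquad \hat N=\sqrt{|\hat Q|}. \] Rates: $\psi(s,\boldsymbol\Sigma)=s\log(1+\|\boldsymbol\Sigma\|_F^2/s^2)$ if $s\le\|\boldsymbol\Sigma\|_F$ and $\psi(s,\boldsymbol\Sigma)=\|\boldsymbol\Sigma\|_F$ otherwise; $\bar\psi(s,\boldsymbol\Sigma)=\lambda_{\max}(\boldsymbol\Sigma)\wedge s$. *)

(* Defs.v *)
From HB Require Import structures.
From mathcomp Require Import all_boot all_order all_algebra.
From mathcomp Require Import all_classical all_reals all_analysis.
Set Implicit Arguments. Unset Strict Implicit. Unset Printing Implicit Defensive.
Import Order.TTheory GRing.Theory Num.Theory.
Import numFieldNormedType.Exports.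
Local Open Scope classical_set_scope.
Local Open Scope ring_scope.

Section Defs.
Variable R : realType.

(* E[f(Z_0,...,Z_{n-1})] for Z_0,...,Z_{n-1} iid N(0,1), as the iterated
   Lebesgue integral against the standard normal law (coordinates >= n are
   frozen at 0 and are never used). *)
Fixpoint iter_gauss (n : nat) (f : (nat -> R) -> \bar R) (z : nat -> R) : \bar R :=
  match n with
  | 0 => f z
  | n'.+1 => (\int[normal_prob (0:R) 1]_x
                iter_gauss n' f (fun k => if k == n' then x else z k))%E
  end.

Definition gauss_expect (n : nat) (f : (nat -> R) -> \bar R) : \bar R :=
  iter_gauss n f (fun _ => 0).

(* Observation Y = theta + sigma * A z, so that eps = A z ~ N(0, A A^T). *)
Definition Yobs d (theta : 'I_d -> R) (sigma : R) (A : 'M[R]_d) (z : nat -> R)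
  : 'I_d -> R := fun i => theta i + sigma * \sum_(j < d) A i j * z j.

Definition covariance_mx d (Sig : 'M[R]_d) : Prop :=
  Sig^T = Sig /\ forall v : 'rV[R]_d, 0 <= (v *m Sig *m v^T) ord0 ord0.

Definition frob d (Sig : 'M[R]_d) : R :=
  Num.sqrt (\sum_(i < d) \sum_(j < d) Sig i j ^+ 2).

Definition lambda_max n (M : 'M[R]_n) : R := sup [set a | eigenvalue M a].

Definition theta_supp d (theta : 'I_d -> R) : {set 'I_d} := [set i | theta i != 0].

Definition principal_submx d (Sig : 'M[R]_d) (S : {set 'I_d}) : 'M[R]_#|S| :=
  \matrix_(i, j) Sig (enum_val i) (enum_val j).

Definition in_B0 d (s : nat) (theta : 'I_d -> R) : Prop := (#|theta_supp theta| <= s)%N.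

Definition sqnorm d (theta : 'I_d -> R) : R := \sum_(i < d) theta i ^+ 2.

Definition in_B2 d (r : R) (theta : 'I_d -> R) : Prop := Num.sqrt (sqnorm theta) <= r.

Definition tau d (s : nat) (Sig : 'M[R]_d) : R :=
  3 * Num.sqrt (ln (1 + frob Sig ^+ 2 / s%:R ^+ 2)).

(* beta_s = E[Z^2 | |Z| >= tau], Z ~ N(0,1) *)
Definition beta (t : R) : R :=
  fine (\int[normal_prob (0:R) 1]_(x in [set x : R | (t <= `|x|)%R]) (x ^+ 2)%:E)%E
  / fine (normal_prob (0:R) 1 [set x : R | t <= `|x|]).

Definition Qhat d (s : nat) (sigma : R) (Sig : 'M[R]_d) (Y : 'I_d -> R) : R :=
  if s%:R <= frob Sig then
    \sum_(i < d) (Y i ^+ 2 - sigma ^+ 2 * Sig i i * beta (tau s Sig))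
                 * (if sigma * Num.sqrt (Sig i i) * tau s Sig < `|Y i| then 1 else 0)
  else \sum_(i < d) (Y i ^+ 2 - sigma ^+ 2 * Sig i i).

Definition Nhat d (s : nat) (sigma : R) (Sig : 'M[R]_d) (Y : 'I_d -> R) : R :=
  Num.sqrt `|Qhat s sigma Sig Y|.

Definition psi d (s : nat) (Sig : 'M[R]_d) : R :=
  if s%:R <= frob Sig then s%:R * ln (1 + frob Sig ^+ 2 / s%:R ^+ 2)
  else frob Sig.

Definition psibar d (s : nat) (Sig : 'M[R]_d) : R := Num.min (lambda_max Sig) s%:R.

End Defs.

(* Main.v *)
(* The error of the quadratic estimator splits into a term linear in the noise,
   a remainder carried by the at most [s] signal coordinates, and a weighted sum
   of scores [g] of the standardized noise, with [g] even and centered under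
   N(0,1). Such a [g] is orthogonal to [1] and [x], so the Mehler kernel bounds
   the covariance of [g X] and [g Y], for standard normals of correlation [rho],
   by [O(rho^2)], with a further factor [expR (- t^2 / 8)] if [g] vanishes on
   [`|x| < t]. Hence the score sum has second moment of order [expR (- t^2 / 8)]
   times the squared Frobenius norm, which the threshold [tau] brings down to
   [s^2]. The bound on the norm estimator follows because
   [(sqrt a - sqrt b)^2] is at most both [`|a - b|] and [(a - b)^2 / b]. *)
Require Import Defs.
From HB Require Import structures.
From mathcomp Require Import all_boot all_order all_algebra.
From mathcomp Require Import all_classical all_reals all_analysis.
From mathcomp Require Import measurable_realfun.
From mathcomp Require Import ring lra.
Set Implicit Arguments. Unset Strict Implicit. Unset Printing Implicit Defensive.
Import Order.TTheory GRing.Theory Num.Theory.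
Local Open Scope classical_set_scope.
Local Open Scope ring_scope.

Local Notation std_normal := (normal_prob 0 1).
Local Notation std_pdf := (normal_pdf 0 1).

(** * Integrals of nonnegative functions *)

Lemma measurable_fun_std_pdf (R : realType) d (T : measurableType d) (D : set T)
    (f : T -> R) : measurable_fun D f -> measurable_fun D (fun x => std_pdf (f x)).
Proof. by move=> mf; apply: measurableT_comp mf; exact: measurable_normal_pdf. Qed.

Lemma measurable_fun_expR (R : realType) d (T : measurableType d) (D : set T)
    (f : T -> R) : measurable_fun D f -> measurable_fun D (fun x => expR (f x)).
Proof. by move=> mf; apply: measurableT_comp mf; exact: measurable_expR. Qed.

Lemma measurable_fun_indic_gt (R : realType) d (T : measurableType d) (c : R)
    (f h : T -> R) : measurable_fun setT f -> measurable_fun setT h ->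
  measurable_fun setT (fun x => f x * (if c < `|h x| then 1 else 0)).
Proof.
move=> mf mh; apply: measurable_funM => //; apply: measurable_fun_ifT => //.
by apply: measurable_fun_ltr => //; exact: measurableT_comp.
Qed.

Ltac solve_measurable := lazymatch goal with
  | |- measurable_fun _ (fun _ => ?c) => exact: measurable_cst
  | |- measurable_fun _ (fun x => x) => exact: measurable_id
  | |- measurable_fun _ (fun x => fst x) => exact: measurable_fst
  | |- measurable_fun _ (fun x => snd x) => exact: measurable_snd
  | |- measurable_fun _ (fun x => fst (@?f x)) =>
      apply: (measurableT_comp measurable_fst) => /=; solve_measurable
  | |- measurable_fun _ (fun x => snd (@?f x)) =>
      apply: (measurableT_comp measurable_snd) => /=; solve_measurable
  | |- measurable_fun _ (fun x => (@?f x, @?g x)) =>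
      apply: measurable_fun_pair => /=; solve_measurable
  | |- measurable_fun _ (fun x => GRing.add (@?f x) (GRing.opp (@?g x))) =>
      apply: measurable_funB => /=; solve_measurable
  | |- measurable_fun _ (fun x => GRing.add (@?f x) (@?g x)) =>
      apply: measurable_funD => /=; solve_measurable
  | |- measurable_fun _ (fun x => GRing.opp (@?f x)) =>
      apply: measurableT_comp => /=; [exact: oppr_measurable|solve_measurable]
  | |- measurable_fun _ (fun x => GRing.mul (@?f x) (@?g x)) =>
      apply: measurable_funM => /=; solve_measurable
  | |- measurable_fun _ (fun x => GRing.exp (@?f x) _) =>
      apply: measurable_funX => /=; solve_measurable
  | |- measurable_fun _ (normal_pdf _ _) => exact: measurable_normal_pdf
  | |- measurable_fun _ (fun x => normal_pdf _ _ (@?f x)) =>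
      apply: measurable_fun_std_pdf => /=; solve_measurable
  | |- measurable_fun _ (fun x => expR (@?f x)) =>
      apply: measurable_fun_expR => /=; solve_measurable
  | |- measurable_fun _ (fun x => (@?f x)%:E) =>
      apply/measurable_EFinP => /=; solve_measurable
  | |- measurable_fun _ (fun x => (@?f x * @?g x)%E) =>
      apply: emeasurable_funM => /=; solve_measurable
  | |- _ => try assumption
  end.

Section lebesgue_affine.
Variable R : realType.
Local Notation mu := (@lebesgue_measure R).

Lemma ge0_integral_affine (r m : R) (f : R -> \bar R) : 0 < r ->
  measurable_fun setT f -> (forall x, 0 <= f x)%E ->
  (r%:E * \int[mu]_x f (r * x + m)%R = \int[mu]_x f x)%E.
Proof.
move=> r0 mf f0.
pose h : measurableTypeR R -> measurableTypeR R := fun x => r * x + m.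
have mh : measurable_fun setT h by rewrite /h; solve_measurable.
have hE a b : h @^-1` `]a, b] = `](a - m) / r, (b - m) / r]%classic.
  by apply/seteqP; split=> x /=; rewrite !in_itv/= /h ltr_pdivrMr// ler_pdivlMr//
    ltrBlDr lerBrDr (mulrC x).
have := ge0_integral_pushforward mh mu measurableT mf (fun x _ => f0 x).
rewrite preimage_setT => <-.
rewrite -(@ge0_integral_mscale _ _ _ _ setT _ (NngNum (ltW r0)))//.
apply: eq_measure_integral => A mA _; apply/esym.
apply: lebesgue_measure_unique => //= _ [[a b]] _ <-.
rewrite /mscale/= /pushforward hE !lebesgue_measure_itv/= !lte_fin.
rewrite ltr_pM2r ?invr_gt0// ltrD2r; case: ifPn => _; last by rewrite mule0.
by rewrite -!EFinD -EFinM; congr EFin; field; exact: lt0r_neq0.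
Qed.

Lemma ge0_integral_translation (m : R) (f : R -> \bar R) :
  measurable_fun setT f -> (forall x, 0 <= f x)%E ->
  (\int[mu]_x f (x + m)%R = \int[mu]_x f x)%E.
Proof.
move=> mf f0; rewrite -[RHS](ge0_integral_affine m ltr01 mf f0) mul1e.
by under [RHS]eq_integral do rewrite mul1r.
Qed.

End lebesgue_affine.

Section real_integral_bounds.
Variables (R : realType) (d' : measure_display) (T : measurableType d').
Variable m : {measure set T -> \bar R}.
Implicit Types (f g : T -> R) (B C k : R).

Lemma ge0_integral_le_trans f g B : measurable_fun setT f -> measurable_fun setT g ->
  (forall x, 0 <= f x) -> (forall x, f x <= g x) ->
  (\int[m]_x (g x)%:E <= B%:E)%E -> (\int[m]_x (f x)%:E <= B%:E)%E.
Proof.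
move=> mf mg f0 fg; apply: le_trans; apply: ge0_le_integral => //.
- by move=> x _; rewrite lee_fin.
- exact/measurable_EFinP.
- exact/measurable_EFinP.
- by move=> x _; rewrite lee_fin.
Qed.

Lemma ge0_integral_leD f g B C : measurable_fun setT f -> measurable_fun setT g ->
  (forall x, 0 <= f x) -> (forall x, 0 <= g x) ->
  (\int[m]_x (f x)%:E <= B%:E)%E -> (\int[m]_x (g x)%:E <= C%:E)%E ->
  (\int[m]_x (f x + g x)%:E <= (B + C)%:E)%E.
Proof.
move=> mf mg f0 g0 fB gC; under eq_integral do rewrite EFinD.
rewrite ge0_integralD//; first by rewrite EFinD; exact: leeD.
- by move=> x _; rewrite lee_fin.
- exact/measurable_EFinP.
- by move=> x _; rewrite lee_fin.
- exact/measurable_EFinP.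
Qed.

Lemma ge0_integral_leZ k f B : 0 <= k -> measurable_fun setT f ->
  (forall x, 0 <= f x) -> (\int[m]_x (f x)%:E <= B%:E)%E ->
  (\int[m]_x (k * f x)%:E <= (k * B)%:E)%E.
Proof.
move=> k0 mf f0 fB; under eq_integral do rewrite EFinM.
rewrite ge0_integralZl//; first by rewrite EFinM; apply: lee_wpmul2l.
- exact/measurable_EFinP.
- by move=> x _; rewrite lee_fin.
Qed.

Lemma ge0_integral_le_sum (I : Type) (s : seq I) (f : I -> T -> R) (B : I -> R) :
  (forall i, measurable_fun setT (f i)) -> (forall i x, 0 <= f i x) ->
  (forall i, \int[m]_x (f i x)%:E <= (B i)%:E)%E ->
  (\int[m]_x (\sum_(i <- s) f i x)%:E <= (\sum_(i <- s) B i)%:E)%E.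
Proof.
move=> mf f0 fB; elim: s => [|i s IHs].
  by under eq_integral do rewrite big_nil; rewrite big_nil integral0.
rewrite big_cons; under eq_integral do rewrite big_cons.
apply: ge0_integral_leD => //; first exact: measurable_sum.
by move=> x; exact: sumr_ge0.
Qed.

End real_integral_bounds.

Lemma integral_norm_le_of_sqr (R : realType) d (T : measurableType d)
    (P : probability T R) (f : T -> R) (k : R) : measurable_fun setT f -> 0 <= k ->
  (\int[P]_x (f x ^+ 2)%:E <= (k ^+ 2)%:E)%E -> (\int[P]_x `|f x|%:E <= k%:E)%E.
Proof.
move=> mf k0 f2_le; apply/lee_addgt0Pr => e e0; rewrite -EFinD.
set c := k + e; have c0 : 0 < c by rewrite /c; lra.
have mabs : measurable_fun setT (fun x => `|f x|) by exact: measurableT_comp.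
have mf2 : measurable_fun setT (fun x => f x ^+ 2) by solve_measurable.
apply: (ge0_integral_le_trans (g := fun x => (2 * c)^-1 * f x ^+ 2 + c / 2)) => //.
- by solve_measurable.
- move=> x /=; rewrite -(@ler_pM2l _ (2 * c)) ?mulr_gt0// [leRHS]mulrDr.
  rewrite mulVKf; last first.
    by rewrite mulf_neq0// lt0r_neq0.
  by have := sqr_ge0 (`|f x| - c); have := real_normK (num_real (f x)); lra.
rewrite [X in X%:E](_ : c = (2 * c)^-1 * c ^+ 2 + c / 2); last first.
  by field; rewrite lt0r_neq0.
apply: ge0_integral_leD.
- by solve_measurable.
- by solve_measurable.
- by move=> x; rewrite mulr_ge0 ?sqr_ge0// invr_ge0 mulr_ge0// ltW.
- by move=> x; rewrite divr_ge0// ltW.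
- apply: ge0_integral_leZ => //; first by rewrite invr_ge0 mulr_ge0// ltW.
    by move=> x; exact: sqr_ge0.
  apply: (le_trans f2_le); rewrite lee_fin; apply: lerXn2r; rewrite ?nnegrE ?(ltW c0)//.
  by rewrite /c lerDl ltW.
- by rewrite integral_cst// [X in (_ * X)%E]probability_setT mule1.
Qed.

(** * The standard normal law *)

Section std_normal_integral.
Variable R : realType.
Local Notation mu := (@lebesgue_measure R).
Implicit Types f : R -> \bar R.

Lemma std_pdfE (x : R) : std_pdf x = normal_peak 1 * expR (- x ^+ 2 / 2).
Proof. by rewrite normal_pdfE ?oner_neq0// /normal_fun subr0 expr1n mulr2n. Qed.

Lemma std_pdf_ge0 (x : R) : 0 <= std_pdf x :> R.
Proof. exact: normal_pdf_ge0. Qed.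

Lemma ge0_integral_std_normal f :
  measurable_fun setT f -> (forall x, 0 <= f x)%E ->
  (\int[std_normal]_x f x = \int[mu]_x (f x * (std_pdf x)%:E))%E.
Proof.
move=> mf f0; have dom := @normal_prob_dominates R 0 1.
have mpdf : measurable_fun setT (EFin \o @normal_pdf R 0 1).
  by apply/measurable_EFinP; exact: measurable_normal_pdf.
rewrite -(Radon_Nikodym_SigmaFinite.change_of_variables dom f0)//.
have If := Radon_Nikodym_SigmaFinite.f_integrable dom.
apply: ae_eq_integral => //.
- by apply: emeasurable_funM => //; exact: measurable_int If.
- exact: emeasurable_funM.
- apply: ae_eqe_mul2l; apply: integral_ae_eq => //= A _ mA.
  by rewrite -(Radon_Nikodym_SigmaFinite.f_integral dom).
Qed.

Lemma integral_std_normal_cst (c : \bar R) : (\int[std_normal]_x c = c)%E.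
Proof.
by rewrite (integral_cst _ measurableT) [X in (_ * X)%E]probability_setT mule1.
Qed.

Lemma ge0_integral_std_normalN f :
  measurable_fun setT f -> (forall x, 0 <= f x)%E ->
  (\int[std_normal]_x f (- x)%R = \int[std_normal]_x f x)%E.
Proof.
move=> mf f0.
have mN : measurable_fun setT (-%R : measurableTypeR R -> measurableTypeR R).
  exact: oppr_measurable.
have mfphi : measurable_fun setT (fun x => f x * (std_pdf x)%:E)%E.
  by solve_measurable.
have fphi0 x : (0 <= f x * (std_pdf x)%:E)%E.
  by rewrite mule_ge0// lee_fin std_pdf_ge0.
rewrite !ge0_integral_std_normal//; last exact: (measurableT_comp mf mN).
transitivity (\int[pushforward mu (-%R : _ -> measurableTypeR R)]_x
  (f x * (std_pdf x)%:E))%E; last first.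
  by apply: eq_measure_integral => A mA _; exact: lebesgue_measureN.
have -> := ge0_integral_pushforward mN mu measurableT mfphi (fun x _ => fphi0 x).
by apply: eq_integral => x _; rewrite /= !std_pdfE sqrrN.
Qed.

Lemma integral_std_normal_odd (f : R -> R) :
  (std_normal : probability _ R).-integrable setT (EFin \o f) ->
  (forall x, f (- x) = - f x) -> (\int[std_normal]_x (f x)%:E = 0)%E.
Proof.
move=> intf fN; have mf := measurable_int _ intf.
have posE : (\int[std_normal]_x (EFin \o f)^\- (- x)%R
    = \int[std_normal]_x (EFin \o f)^\+ x)%E.
  by apply: eq_integral => x _; rewrite funenegE funeposE /= fN opprK.
rewrite integralE -posE ge0_integral_std_normalN//; last exact: measurable_funeneg.
by rewrite subee// integrable_neg_fin_num.
Qed.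

End std_normal_integral.

(* A rotation is a product of three shears, each of which preserves the
   Lebesgue measure by Tonelli and translation invariance. *)
Section rotation_invariance.
Variable R : realType.
Local Notation mu := (@lebesgue_measure R).
Implicit Types (F : R * R -> \bar R) (c s : R).

Lemma ge0_integral_shear1 (a : R) F : measurable_fun setT F -> (forall p, 0 <= F p)%E ->
  (\int[mu]_x \int[mu]_t F (x + a * t, t)%R = \int[mu]_x \int[mu]_t F (x, t))%E.
Proof.
move=> mF F0; pose shear (p : R * R) := F (p.1 + a * p.2, p.2).
have mshear : measurable_fun setT shear.
  by apply: (measurableT_comp mF); solve_measurable.
transitivity (\int[mu]_t \int[mu]_x shear (x, t))%E.
  exact: (@fubini_tonelli _ _ _ _ _ mu mu shear mshear (fun p => F0 _)).
transitivity (\int[mu]_t \int[mu]_x F (x, t))%E; last first.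
  exact/esym/(@fubini_tonelli _ _ _ _ _ mu mu F mF F0).
apply: eq_integral => t _.
apply: (@ge0_integral_translation R (a * t) (fun x => F (x, t))) => //.
by apply: (measurableT_comp mF); solve_measurable.
Qed.

Lemma ge0_integral_shear2 (a : R) F : measurable_fun setT F -> (forall p, 0 <= F p)%E ->
  (\int[mu]_x \int[mu]_t F (x, t + a * x)%R = \int[mu]_x \int[mu]_t F (x, t))%E.
Proof.
move=> mF F0; apply: eq_integral => x _.
apply: (@ge0_integral_translation R (a * x) (fun t => F (x, t))) => //.
by apply: (measurableT_comp mF); solve_measurable.
Qed.

Lemma ge0_integral_rotation c s F : s != 0 -> c ^+ 2 + s ^+ 2 = 1 ->
  measurable_fun setT F -> (forall p, 0 <= F p)%E ->
  (\int[mu]_x \int[mu]_t F (c * x - s * t, s * x + c * t)%R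
   = \int[mu]_x \int[mu]_t F (x, t))%E.
Proof.
move=> s0 cs mF F0; pose a := (c - 1) / s.
pose F1 (p : R * R) := F (p.1 + a * p.2, p.2).
pose F2 (p : R * R) := F1 (p.1, p.2 + s * p.1).
have mF1 : measurable_fun setT F1 by apply: (measurableT_comp mF); solve_measurable.
have mF2 : measurable_fun setT F2 by apply: (measurableT_comp mF1); solve_measurable.
transitivity (\int[mu]_x \int[mu]_t F1 (x, t))%E; last exact: ge0_integral_shear1.
transitivity (\int[mu]_x \int[mu]_t F2 (x, t))%E; last first.
  by apply: ge0_integral_shear2 => // p; exact: F0.
transitivity (\int[mu]_x \int[mu]_t F2 (x + a * t, t)%R)%E; last first.
  by apply: ge0_integral_shear1 => // p; exact: F0.
apply: eq_integral => x _; apply: eq_integral => t _; rewrite /F2 /F1 /=.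
have as1 : a * s = c - 1 by rewrite /a divfK.
have sE : - s = a * (1 + c).
  by apply: (mulIf s0); rewrite mulrAC as1; lra.
congr (F (_, _)).
  transitivity ((1 + a * s) * x + a * (2 + a * s) * t); last by ring.
  by rewrite as1 (_ : 2 + (c - 1) = 1 + c) -?sE; ring.
transitivity (s * x + (1 + a * s) * t); last by ring.
by rewrite as1; ring.
Qed.

Lemma std_pdf_rotation c s (x t : R) : c ^+ 2 + s ^+ 2 = 1 ->
  std_pdf (c * x - s * t) * std_pdf (s * x + c * t) = std_pdf x * std_pdf t.
Proof.
move=> cs; rewrite !std_pdfE mulrACA [RHS]mulrACA -!expRD; congr (_ * expR _).
transitivity ((c ^+ 2 + s ^+ 2) * (- x ^+ 2 / 2 + - t ^+ 2 / 2)); first by field.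
by rewrite cs mul1r.
Qed.

Lemma ge0_integral_std_normal2 F : measurable_fun setT F -> (forall p, 0 <= F p)%E ->
  (\int[std_normal]_x \int[std_normal]_t F (x, t)
   = \int[mu]_x \int[mu]_t (F (x, t) * (std_pdf x * std_pdf t)%:E))%E.
Proof.
move=> mF F0; rewrite ge0_integral_std_normal; last 2 first.
- exact: (@measurable_fun_fubini_tonelli_F _ _ _ _ _ std_normal F).
- by move=> x; exact: integral_ge0.
apply: eq_integral => x _.
have mFx : measurable_fun setT (fun t => F (x, t)).
  by apply: (measurableT_comp mF); solve_measurable.
rewrite ge0_integral_std_normal// -ge0_integralZr//.
- by apply: eq_integral => t _; rewrite -muleA -EFinM (mulrC (std_pdf t)).
- by solve_measurable.
- by move=> t _; rewrite mule_ge0// lee_fin std_pdf_ge0.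
- by rewrite lee_fin std_pdf_ge0.
Qed.

Lemma ge0_integral_std_normal_rotation c s F : 0 <= c -> c ^+ 2 + s ^+ 2 = 1 ->
  measurable_fun setT F -> (forall p, 0 <= F p)%E ->
  (\int[std_normal]_x \int[std_normal]_t F (c * x - s * t, s * x + c * t)%R
   = \int[std_normal]_x \int[std_normal]_t F (x, t))%E.
Proof.
move=> c0 cs mF F0; have [s0|s0] := eqVneq s 0.
  have c1 : c = 1.
    have : c ^+ 2 == 1 by rewrite -cs s0 expr0n addr0.
    by rewrite sqrf_eq1 => /orP[/eqP//|/eqP cN1]; lra.
  apply: eq_integral => x _; apply: eq_integral => t _; congr (F (_, _));
    by rewrite s0 c1; ring.
pose Frot (p : R * R) := F (c * p.1 - s * p.2, s * p.1 + c * p.2).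
have mFrot : measurable_fun setT Frot.
  by apply: (measurableT_comp mF); solve_measurable.
pose G p := (F p * (std_pdf p.1 * std_pdf p.2)%:E)%E.
have mG : measurable_fun setT G by rewrite /G; solve_measurable.
have G0 p : (0 <= G p)%E by rewrite mule_ge0// lee_fin mulr_ge0 ?std_pdf_ge0.
transitivity (\int[mu]_x \int[mu]_t G (x, t))%E; last first.
  by apply/esym; exact: ge0_integral_std_normal2.
rewrite -(ge0_integral_rotation s0 cs mG G0).
apply: (etrans (ge0_integral_std_normal2 mFrot (fun p => F0 _))).
apply: eq_integral => x _; apply: eq_integral => t _.
by rewrite /G/= std_pdf_rotation.
Qed.

End rotation_invariance.

Section expR_bounds.
Variable R : realType.
Implicit Types x w : R.

Lemma ger_expR x : x <= expR x.
Proof. by apply: le_trans (expR_ge1Dx x); rewrite lerDr. Qed.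

Lemma sqr_le_expR x : 0 <= x -> x ^+ 2 <= 4 * expR x.
Proof.
move=> x0.
have -> : expR x = expR (x / 2) ^+ 2 by rewrite -expRM_natl; congr expR; field.
have -> : x ^+ 2 = 4 * (x / 2) ^+ 2 by field.
rewrite ler_pM2l//; apply: lerXn2r (ger_expR _); rewrite nnegrE ?expR_ge0//.
exact: divr_ge0.
Qed.

Lemma normr_expRB1_le w : `|expR w - 1| <= `|w| * expR `|w|.
Proof.
have le1Dw := expR_ge1Dx w; have le1Nw := expR_ge1Dx (- w).
have expRwK : expR w * expR (- w) = 1 by rewrite -expRD subrr expR0.
have w_gt0 := expR_gt0 w; have [w0|w0] := leP 0 w.
  by rewrite !ger0_norm//; [nra|lra].
rewrite (ltr0_norm w0) ler0_norm; last by rewrite subr_le0 -expR0 ler_expR ltW.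
have : 1 <= expR (- w) by rewrite -expR0 ler_expR; lra.
by nra.
Qed.

Lemma normr_expRB1B_le w : `|expR w - 1 - w| <= w ^+ 2 * expR `|w|.
Proof.
have le1Dw := expR_ge1Dx w; have le1Nw := expR_ge1Dx (- w).
have expRwK : expR w * expR (- w) = 1 by rewrite -expRD subrr expR0.
have w_gt0 := expR_gt0 w.
rewrite ger0_norm; last by lra.
have /le_trans-> // : expR w - 1 - w <= w * (expR w - 1) by nra.
apply: (le_trans (ler_norm _)); rewrite normrM -[w ^+ 2]real_normK ?num_real//.
by rewrite expr2 -mulrA; apply: ler_wpM2l => //; exact: normr_expRB1_le.
Qed.

End expR_bounds.

Section std_normal_moments.
Variable R : realType.
Local Notation mu := (@lebesgue_measure R).
Implicit Types f : R -> R.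

Lemma std_normal_expR_sqr (s : R) : 0 < s ->
  (\int[std_normal]_x (expR ((1 - s ^- 2) / 2 * x ^+ 2))%:E = s%:E)%E.
Proof.
move=> s0; have sn0 : s != 0 by exact: lt0r_neq0.
rewrite ge0_integral_std_normal; last 2 first.
- by solve_measurable.
- by move=> x; rewrite lee_fin expR_ge0.
transitivity (\int[mu]_x (s%:E * (normal_pdf 0 s x)%:E))%E; last first.
  rewrite integralZl//; last exact: integrable_normal_pdf.
  by rewrite integral_normal_pdf mule1.
apply: eq_integral => x _; rewrite -!EFinM; congr EFin.
rewrite (normal_pdfE _ sn0) std_pdfE /normal_fun subr0 mulrCA -expRD [RHS]mulrA.
congr (_ * expR _); last by rewrite -exprVn; field.
rewrite /normal_peak expr1n mul1r -mulrnAr sqrtrM ?sqr_ge0// sqrtr_sqr gtr0_norm//.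
by rewrite invfM mulrA divff// mul1r.
Qed.

Lemma std_normal_expR_sqr4 :
  (\int[std_normal]_x (expR (x ^+ 2 / 4))%:E = (Num.sqrt (2 : R))%:E)%E.
Proof.
have s2 : 0 < Num.sqrt (2 : R) by rewrite sqrtr_gt0.
rewrite -(std_normal_expR_sqr s2) sqr_sqrtr//.
by apply: eq_integral => x _; congr (expR _)%:E; field.
Qed.

Lemma ge0_std_normal_le_expR_sqr4 f (C : R) : measurable_fun setT f ->
  (forall x, 0 <= f x) -> (forall x, f x <= C * expR (x ^+ 2 / 4)) ->
  (\int[std_normal]_x (f x)%:E <= (2 * C)%:E)%E.
Proof.
move=> mf f0 fC.
have C0 : 0 <= C.
  by have := le_trans (f0 0) (fC 0); rewrite pmulr_lge0// expR_gt0.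
apply: (ge0_integral_le_trans (m := std_normal)
  (g := fun x => C * expR (x ^+ 2 / 4))) => //.
  by solve_measurable.
rewrite mulrC; apply: ge0_integral_leZ => //; first by solve_measurable.
rewrite std_normal_expR_sqr4 lee_fin -(@ler_pXn2r _ 2) ?nnegrE ?sqrtr_ge0//.
by rewrite sqr_sqrtr//; lra.
Qed.

Lemma integral_expR_sqr4_le (D : set R) : measurable D ->
  (\int[std_normal]_(x in D) (expR (x ^+ 2 / 4))%:E <= 2%:E)%E.
Proof.
move=> mD; apply: (@le_trans _ _ (\int[std_normal]_x (expR (x ^+ 2 / 4))%:E)%E).
  by apply: ge0_subset_integral => //; solve_measurable.
rewrite -(mulr1 2); apply: ge0_std_normal_le_expR_sqr4 => [|x|x].
- by solve_measurable.
- exact: expR_ge0.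
- by rewrite mul1r.
Qed.

Lemma std_normal_integrable_le_expR_sqr4 f (C : R) : measurable_fun setT f ->
  (forall x, `|f x| <= C * expR (x ^+ 2 / 4)) ->
  (std_normal : probability _ R).-integrable setT (EFin \o f).
Proof.
move=> mf fC; apply/integrableP; split; first exact/measurable_EFinP.
apply: (@le_lt_trans _ _ (2 * C)%:E); last exact: ltry.
apply: (ge0_std_normal_le_expR_sqr4 (f := fun x => `|f x|)) => //.
exact: measurableT_comp.
Qed.

Lemma std_normal_integrable_sqr :
  (std_normal : probability _ R).-integrable setT (EFin \o (fun x : R => x ^+ 2)).
Proof.
apply: (@std_normal_integrable_le_expR_sqr4 _ 4); first by solve_measurable.
by move=> x; rewrite ger0_norm ?sqr_ge0//; have := ger_expR (x ^+ 2 / 4); lra.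
Qed.

(* Integrating [1 + k x^2 <= expR (k x^2)] gives [1 + k m <= s] for the second
   moment [m], where [2 k = 1 - s^-2]; at [s = (1 + m) / 2] this reads
   [(m - 1)^2 <= 0]. *)
Lemma std_normal_second_moment : (\int[std_normal]_x (x ^+ 2)%:E = (1 : R)%:E)%E.
Proof.
have isqr := std_normal_integrable_sqr.
have [m m_def] : exists m : R, (\int[std_normal]_x (x ^+ 2)%:E = m%:E)%E.
  by eexists; apply/esym/fineK/integrable_fin_num.
have m0 : 0 <= m.
  by rewrite -lee_fin -m_def; apply: integral_ge0 => x _; rewrite lee_fin sqr_ge0.
pose s := (1 + m) / 2; pose k := (1 - s ^- 2) / 2.
have s0 : 0 < s by rewrite /s; lra.
have le_s : 1 + k * m <= s.
  rewrite -lee_fin -(std_normal_expR_sqr s0) EFinD EFinM -m_def.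
  rewrite -integralZl// -[1%:E]integral_std_normal_cst.
  have icst : (std_normal : probability _ R).-integrable setT (cst 1%:E).
    exact: finite_measure_integrable_cst.
  rewrite -integralD//; last exact: integrableZl.
  apply: le_integral => //.
  - by apply: integrableD => //; exact: integrableZl.
  - apply/integrableP; split; first by solve_measurable.
    under eq_integral do rewrite gee0_abs ?lee_fin ?expR_ge0//.
    by rewrite std_normal_expR_sqr// ltry.
  - by move=> x _; rewrite lee_fin; exact: expR_ge1Dx.
have s2 : 0 < 2 * s ^+ 2 by rewrite mulr_gt0// exprn_gt0.
have : (1 + k * m) * (2 * s ^+ 2) <= s * (2 * s ^+ 2) by rewrite ler_pM2r.
have -> : (1 + k * m) * (2 * s ^+ 2) = 2 * s ^+ 2 + (s ^+ 2 - 1) * m.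
  by rewrite /k; field; exact: lt0r_neq0.
have mE : m = 2 * s - 1 by rewrite /s; field.
rewrite [in X in X -> _]mE => le_s3.
have /eqP : (s - 1) ^+ 2 == 0 by rewrite eq_le sqr_ge0 andbT; lra.
move/eqP; rewrite sqrf_eq0 subr_eq0 => /eqP s1.
by rewrite m_def mE s1; congr EFin; ring.
Qed.

End std_normal_moments.

(** * The Mehler kernel *)

Section signed_transfer.
Variable R : realType.
Local Open Scope ereal_scope.

Lemma eq_integral_ge0_weight d1 d2 d (T1 : measurableType d1) (T2 : measurableType d2)
    (Y : measurableType d) (m1 : {measure set T1 -> \bar R})
    (m2 : {measure set T2 -> \bar R}) (X1 : T1 -> Y) (X2 : T2 -> Y) (k : T2 -> R) :
  (forall y, 0 <= k y)%R ->
  (forall h : Y -> \bar R, measurable_fun setT h -> (forall u, 0 <= h u) ->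
    \int[m1]_x h (X1 x) = \int[m2]_y (h (X2 y) * (k y)%:E)) ->
  forall h : Y -> \bar R, measurable_fun setT h ->
    \int[m1]_x h (X1 x) = \int[m2]_y (h (X2 y) * (k y)%:E).
Proof.
move=> k0 ge0_law.
have maxE (h : Y -> \bar R) : measurable_fun setT h ->
    \int[m1]_x maxe (h (X1 x)) 0 = \int[m2]_y maxe (h (X2 y) * (k y)%:E) 0.
  move=> mh; rewrite (ge0_law (fun u => maxe (h u) 0)).
  - by apply: eq_integral => u _; rewrite maxe_pMl ?mul0e ?lee_fin.
  - exact: measurable_maxe.
  - by move=> u; rewrite le_max lexx orbT.
move=> h mh; rewrite integralE [RHS]integralE; congr (_ - _).
  under eq_integral do rewrite funeposE.
  by under [RHS]eq_integral do rewrite funeposE; exact: maxE.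
under eq_integral do rewrite funenegE.
under [RHS]eq_integral do rewrite funenegE -mulNe.
by apply: (maxE (fun u => - h u)); exact: measurableT_comp.
Qed.

Lemma eq_integral_ge0 d1 d2 d (T1 : measurableType d1) (T2 : measurableType d2)
    (Y : measurableType d) (m1 : {measure set T1 -> \bar R})
    (m2 : {measure set T2 -> \bar R}) (X1 : T1 -> Y) (X2 : T2 -> Y) :
  (forall h : Y -> \bar R, measurable_fun setT h -> (forall u, 0 <= h u) ->
    \int[m1]_x h (X1 x) = \int[m2]_y h (X2 y)) ->
  forall h : Y -> \bar R, measurable_fun setT h ->
    \int[m1]_x h (X1 x) = \int[m2]_y h (X2 y).
Proof.
move=> ge0_law h mh.
rewrite (eq_integral_ge0_weight (m2 := m2) (X2 := X2) (k := cst 1%R)) => //.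
  by apply: eq_integral => y _; rewrite mule1.
move=> h' mh' h'0; rewrite ge0_law//.
by apply: eq_integral => y _; rewrite mule1.
Qed.

End signed_transfer.

Section mehler_kernel.
Variable R : realType.
Local Notation mu := (@lebesgue_measure R).
Implicit Types rho r x u : R.

(* Density with respect to N(0,1) of the conditional law of [rho x + r Y],
   where Y ~ N(0,1) and [rho^2 + r^2 = 1]. *)
Definition mehler rho r x u : R :=
  r^-1 * expR ((2 * rho * x * u - rho ^+ 2 * (x ^+ 2 + u ^+ 2)) / (2 * r ^+ 2)).

Lemma mehler_ge0 rho r x u : 0 <= r -> 0 <= mehler rho r x u.
Proof. by move=> r0; rewrite mulr_ge0 ?expR_ge0// invr_ge0. Qed.

Lemma mehler_std_pdf rho r x u : 0 < r -> rho ^+ 2 + r ^+ 2 = 1 ->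
  mehler rho r x u * std_pdf u = r^-1 * std_pdf ((u - rho * x) / r).
Proof.
move=> r0 rr; rewrite /mehler !std_pdfE -[LHS]mulrA; congr (_ * _).
rewrite mulrCA -expRD; congr (_ * expR _).
have rn0 : r != 0 by exact: lt0r_neq0.
transitivity ((2 * rho * x * u - rho ^+ 2 * x ^+ 2 - (rho ^+ 2 + r ^+ 2) * u ^+ 2)
  / (2 * r ^+ 2)); first by field.
by rewrite rr; field.
Qed.

Lemma ge0_integral_mehler rho r x (f : R -> \bar R) : 0 < r ->
  rho ^+ 2 + r ^+ 2 = 1 -> measurable_fun setT f -> (forall u, 0 <= f u)%E ->
  (\int[std_normal]_y f (rho * x + r * y)%R
   = \int[std_normal]_u (f u * (mehler rho r x u)%:E))%E.
Proof.
move=> r0 rr mf f0.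
pose h u := (f u * (std_pdf ((u - rho * x) / r))%:E)%E.
have mh : measurable_fun setT h by rewrite /h; solve_measurable.
have h0 u : (0 <= h u)%E by rewrite mule_ge0// lee_fin std_pdf_ge0.
have ri0 : (0 <= r^-1%:E)%E by rewrite lee_fin invr_ge0 ltW.
transitivity (r^-1%:E * \int[mu]_u h u)%E.
  rewrite -(ge0_integral_affine (rho * x) r0 mh h0) muleA -EFinM.
  rewrite mulVf ?lt0r_neq0// mul1e ge0_integral_std_normal; last 2 first.
  - by apply: (measurableT_comp mf); solve_measurable.
  - by move=> y.
  apply: eq_integral => y _; rewrite /h addrK (mulrC r) mulfK ?lt0r_neq0//.
  by rewrite addrC (mulrC y).
rewrite -ge0_integralZl// ge0_integral_std_normal; last 2 first.
- by rewrite /mehler; solve_measurable.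
- by move=> u; rewrite mule_ge0// lee_fin mehler_ge0// ltW.
apply: eq_integral => u _; rewrite muleCA -EFinM -muleA -EFinM.
by rewrite mehler_std_pdf.
Qed.

Lemma integral_mehler rho r x (f : R -> \bar R) : 0 < r ->
  rho ^+ 2 + r ^+ 2 = 1 -> measurable_fun setT f ->
  (\int[std_normal]_y f (rho * x + r * y)%R
   = \int[std_normal]_u (f u * (mehler rho r x u)%:E))%E.
Proof.
move=> r0 rr.
apply: (@eq_integral_ge0_weight R _ _ _ _ _ R std_normal std_normal
  (fun y : R => rho * x + r * y) id (mehler rho r x)) => [u|h mh h0].
  exact: mehler_ge0 (ltW r0).
exact: ge0_integral_mehler.
Qed.

Lemma invr_1Bsqr_bounds (a i : R) : 0 <= a <= 1 / 2 -> i * (1 - a ^+ 2) = 1 ->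
  1 <= i <= 1 + 2 * a ^+ 2.
Proof.
move=> /andP[a0 a_small] iE; have a2_ge0 := sqr_ge0 a.
have a2_small : a ^+ 2 <= 1 / 4 by nra.
by apply/andP; split; nra.
Qed.

Lemma mehler_exponent_approx (a i y q : R) : 0 <= a <= 1 / 32 -> 0 <= q ->
  `|y| <= a * q -> i * (1 - a ^+ 2) = 1 ->
  `|i * (y - a ^+ 2 * q) - y| <= 4 * a ^+ 2 * q.
Proof.
move=> /andP[a0 a_small] q0 y_le iE; have a2_ge0 := sqr_ge0 a.
have /andP[i_ge1 i_le] : 1 <= i <= 1 + 2 * a ^+ 2.
  by apply: invr_1Bsqr_bounds => //; rewrite a0; lra.
have i_le2 : i <= 2 by nra.
have y_leq : `|y| <= q by apply: (le_trans y_le); rewrite ler_piMl//; lra.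
have -> : i * (y - a ^+ 2 * q) - y = (i - 1) * y - i * (a ^+ 2 * q) by ring.
apply: (le_trans (ler_normB _ _)); rewrite (normrM (i - 1)) (normrM i).
rewrite (ger0_norm (mulr_ge0 a2_ge0 q0)).
rewrite (@ger0_norm _ (i - 1)) ?(@ger0_norm _ i); [|lra..].
have : (i - 1) * `|y| <= 2 * a ^+ 2 * q by apply: ler_pM => //; lra.
have : i * (a ^+ 2 * q) <= 2 * (a ^+ 2 * q) by apply: ler_wpM2r => //; exact: mulr_ge0.
lra.
Qed.

Lemma perturbed_expR_approx (a p q w y : R) : 0 <= a <= 1 / 32 -> 0 <= q ->
  1 <= p <= 1 + 2 * a ^+ 2 -> `|w| <= 2 * a * q -> `|w - y| <= 4 * a ^+ 2 * q ->
  `|p * expR w - 1 - y| <= 2 ^+ 13 * a ^+ 2 * expR (q / 16) ^+ 2.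
Proof.
move=> /andP[a0 a_small] q0 /andP[p_ge1 p_le] w_le wy_le; set e := expR (q / 16).
have a2_ge0 := sqr_ge0 a.
have e_ge1 : 1 <= e by rewrite -[leLHS]expR0 ler_expR divr_ge0.
have ew_le : expR `|w| <= e.
  by rewrite ler_expR; apply: (le_trans w_le); have := ler_wpM2r q0 a_small; lra.
have prefactor_le : `|(p - 1) * expR w| <= 2 * a ^+ 2 * e ^+ 2.
  rewrite normrM (ger0_norm (expR_ge0 w)) ger0_norm; last by lra.
  apply: ler_pM; [lra|exact: expR_ge0|lra|].
  apply: (@le_trans _ _ e); last by rewrite expr2 ler_peMr//; lra.
  by apply: le_trans ew_le; rewrite ler_expR ler_norm.
have taylor_le : `|expR w - 1 - w| <= 2 ^+ 12 * a ^+ 2 * e ^+ 2.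
  apply: (le_trans (normr_expRB1B_le w)).
  rewrite (expr2 e) (mulrA _ e); apply: ler_pM => //; rewrite ?sqr_ge0 ?expR_ge0//.
  have q2_le : (q / 16) ^+ 2 <= 4 * e by apply: sqr_le_expR; rewrite divr_ge0.
  have : w ^+ 2 <= (2 * a * q) ^+ 2.
    rewrite -[w ^+ 2]real_normK ?num_real//.
    by apply: lerXn2r; rewrite // nnegrE -mulrA mulr_ge0// mulr_ge0.
  have := ler_wpM2l a2_ge0 q2_le; lra.
have linear_le : 4 * a ^+ 2 * q <= 2 ^+ 6 * a ^+ 2 * e ^+ 2.
  have qe : q / 16 <= e ^+ 2 by have := ger_expR (q / 16); rewrite -/e; nra.
  have := ler_wpM2l a2_ge0 qe; lra.
have -> : p * expR w - 1 - y =
    (p - 1) * expR w + (expR w - 1 - w) + (w - y) by ring.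
apply: (le_trans (ler_normD _ _)).
have := ler_normD ((p - 1) * expR w) (expR w - 1 - w).
have : 0 <= a ^+ 2 * e ^+ 2 by rewrite mulr_ge0 ?sqr_ge0.
lra.
Qed.

Lemma mehler_approx rho r x u : `|rho| <= 1 / 32 -> 0 < r ->
  rho ^+ 2 + r ^+ 2 = 1 ->
  `|mehler rho r x u - 1 - rho * (x * u)|
    <= 2 ^+ 13 * rho ^+ 2 * (expR (x ^+ 2 / 16) * expR (u ^+ 2 / 16)).
Proof.
move=> rho_small r0 rr; have rn0 : r != 0 by exact: lt0r_neq0.
pose a := `|rho|; have a_bounds : 0 <= a <= 1 / 32 by rewrite normr_ge0.
have /andP[a0 _] := a_bounds.
have rhoE : rho ^+ 2 = a ^+ 2 by rewrite real_normK ?num_real.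
pose q := (x ^+ 2 + u ^+ 2) / 2; pose y := rho * (x * u).
have q0 : 0 <= q by rewrite divr_ge0// addr_ge0 ?sqr_ge0.
have y_le : `|y| <= a * q.
  rewrite normrM; apply: ler_wpM2l => //; rewrite ler_norml /q.
  by have := sqr_ge0 (x - u); have := sqr_ge0 (x + u) => *; apply/andP; split; lra.
pose i := (r ^+ 2)^-1; pose w := i * (y - a ^+ 2 * q).
have iE : i * (1 - a ^+ 2) = 1.
  by rewrite -rhoE (_ : 1 - rho ^+ 2 = r ^+ 2) ?mulVf ?expf_neq0// -rr; ring.
have /andP[i_ge1 i_le] : 1 <= i <= 1 + 2 * a ^+ 2.
  by apply: invr_1Bsqr_bounds => //; rewrite a0/=; lra.
have rV_bounds : 1 <= r^-1 <= 1 + 2 * a ^+ 2.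
  have rV_gt0 : 0 < r^-1 by rewrite invr_gt0.
  have rVE : r^-1 ^+ 2 = i by rewrite exprVn.
  by apply/andP; split; nra.
have wy_le : `|w - y| <= 4 * a ^+ 2 * q by exact: mehler_exponent_approx.
have w_le : `|w| <= 2 * a * q.
  have a2_small : a ^+ 2 <= a / 32 by rewrite expr2; apply: ler_wpM2l => //; lra.
  have := ler_wpM2r q0 a2_small; have := ler_normD (w - y) y; rewrite subrK.
  by have := mulr_ge0 a0 q0; lra.
have -> : expR (x ^+ 2 / 16) * expR (u ^+ 2 / 16) = expR (q / 16) ^+ 2.
  by rewrite [RHS]expr2 -!expRD; congr expR; rewrite /q; field.
have -> : mehler rho r x u = r^-1 * expR w.
  by rewrite /mehler; congr (_ * expR _); rewrite /w /i -rhoE /q /y; field.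
by rewrite rhoE; exact: perturbed_expR_approx.
Qed.

End mehler_kernel.

(** * Gaussian linear forms *)

Section std_normal_vector.
Variable R : realType.

Definition append_coord n (p : measurableTypeR R * n.-tuple R) : n.+1.-tuple R :=
  [tuple of rcons p.2 p.1].

Lemma measurable_append_coord n : measurable_fun setT (@append_coord n).
Proof.
apply/measurable_fun_tnthP => i; have [i_lt|i_ge] := ltnP i n.
  rewrite (_ : _ \o _ = (fun p : R * n.-tuple R => tnth p.2 (Ordinal i_lt))).
    by apply: (measurableT_comp (measurable_tnth _)); exact: measurable_snd.
  apply/funext => p; rewrite /= !(tnth_nth 0) /= nth_rcons size_tuple.
  by rewrite i_lt.
rewrite (_ : _ \o _ = fst); first exact: measurable_fst.
apply/funext => p; rewrite /= (tnth_nth 0) /= nth_rcons size_tuple ltnNge i_ge/=.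
by rewrite eqn_leq i_ge -ltnS ltn_ord.
Qed.

HB.instance Definition _ n :=
  isMeasurableFun.Build _ _ _ _ _ (@measurable_append_coord n).

Fixpoint normal_vec n : probability (n.-tuple R) R :=
  match n with
  | 0 => \d_[tuple]
  | n'.+1 => distribution (std_normal \x normal_vec n')%E (@append_coord n')
  end.

Lemma ge0_integral_normal_vecS n (f : n.+1.-tuple R -> \bar R) :
  measurable_fun setT f -> (forall t, 0 <= f t)%E ->
  (\int[normal_vec n.+1]_t f t
   = \int[std_normal]_x \int[normal_vec n]_t f (append_coord (x, t)))%E.
Proof.
move=> mf f0; rewrite ge0_integral_distribution// fubini_tonelli1//=.
by apply: measurableT_comp => //; exact: measurable_append_coord.
Qed.

Lemma ge0_iter_gaussE n (f : (nat -> R) -> \bar R) z : (forall w, 0 <= f w)%E ->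
  measurable_fun setT (fun t : n.-tuple R => f (fun k => nth (z k) t k)) ->
  iter_gauss n f z = (\int[normal_vec n]_t f (fun k => nth (z k) t k))%E.
Proof.
move=> f0; elim: n z => [|n IHn] z mf.
  rewrite integral_dirac// diracT mul1e/=; congr f.
  by apply/funext => k; rewrite nth_nil.
have shiftE x (t : n.-tuple R) : (fun k => nth (z k) (append_coord (x, t)) k)
    = (fun k => nth (if k == n then x else z k) t k).
  apply/funext => k; rewrite /= nth_rcons size_tuple; case: ltnP => [k_lt|k_ge].
    by apply: set_nth_default; rewrite size_tuple.
  by rewrite [RHS]nth_default ?size_tuple.
rewrite ge0_integral_normal_vecS//; apply: eq_integral => x _.
apply: (etrans (IHn (fun k => if k == n then x else z k) _)); last first.
  by apply: eq_integral => t _; rewrite shiftE.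
rewrite (_ : (fun t => _) = (fun t : n.-tuple R => f (fun k => nth (z k)
    (append_coord (x, t)) k))); last by apply/funext => t; rewrite shiftE.
apply: (measurableT_comp mf).
by apply: measurableT_comp.
Qed.

Lemma ge0_gauss_expectE n (f : (nat -> R) -> \bar R) : (forall w, 0 <= f w)%E ->
  measurable_fun setT (fun t : n.-tuple R => f (nth 0 t)) ->
  gauss_expect n f = (\int[normal_vec n]_t f (nth 0%R t))%E.
Proof. by move=> f0 mf; rewrite /gauss_expect ge0_iter_gaussE. Qed.

End std_normal_vector.

Section linear_forms.
Variable R : realType.

Definition lin_form n (a : 'I_n -> R) (t : n.-tuple R) : R :=
  \sum_(j < n) a j * tnth t j.

Lemma measurable_lin_form n (a : 'I_n -> R) : measurable_fun setT (lin_form a).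
Proof.
apply: measurable_sum => j; apply: measurable_funM; first by solve_measurable.
exact: measurable_tnth.
Qed.

Lemma lin_form_append n (a : 'I_n.+1 -> R) x (t : n.-tuple R) :
  lin_form a (append_coord (x, t)) =
  lin_form (fun j => a (widen_ord (leqnSn n) j)) t + a ord_max * x.
Proof.
rewrite /lin_form big_ord_recr/=; congr (_ + _ * _).
  apply: eq_bigr => j _; congr (_ * _).
  by rewrite !(tnth_nth 0)/= nth_rcons size_tuple ltn_ord.
by rewrite (tnth_nth 0)/= nth_rcons size_tuple ltnn eqxx.
Qed.

(* Expectation of [h] under the centered normal law on the plane with covariance
   matrix [[p^2, p q], [p q, q^2 + r^2]]. *)
Definition planar_normal (p q r : R) (h : R * R -> \bar R) : \bar R :=
  (\int[std_normal]_x \int[std_normal]_y h (p * x, q * x + r * y)%R)%E.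

Lemma polar_coordinates (p q : R) : 0 <= p -> exists k c s : R,
  [/\ 0 <= k, 0 <= c, c ^+ 2 + s ^+ 2 = 1, p = k * c & q = k * s].
Proof.
move=> p0; set k := Num.sqrt (p ^+ 2 + q ^+ 2).
have k2 : k ^+ 2 = p ^+ 2 + q ^+ 2 by rewrite sqr_sqrtr// addr_ge0 ?sqr_ge0.
have [k0|k0] := eqVneq k 0.
  have : p ^+ 2 + q ^+ 2 == 0 by rewrite -k2 k0 expr0n.
  rewrite paddr_eq0 ?sqr_ge0// !sqrf_eq0 => /andP[/eqP-> /eqP->].
  by exists 0, 1, 0; split; rewrite ?ler01 ?mul0r// expr1n expr0n addr0.
exists k, (p / k), (q / k); split; first exact: sqrtr_ge0.
- by rewrite divr_ge0// sqrtr_ge0.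
- by rewrite !exprMn -mulrDl -k2 exprVn divff// expf_neq0.
- by rewrite mulrCA divff// mulr1.
- by rewrite mulrCA divff// mulr1.
Qed.

Lemma ge0_integral_std_normal_add (r w : R) (f : R -> \bar R) : 0 <= r ->
  measurable_fun setT f -> (forall x, 0 <= f x)%E ->
  (\int[std_normal]_t \int[std_normal]_y f (r * y + w * t)%R
   = \int[std_normal]_y f (Num.sqrt (r ^+ 2 + w ^+ 2) * y)%R)%E.
Proof.
move=> r0 mf f0; have [k [c [s [k0 c0 cs rE wE]]]] := polar_coordinates w r0.
have -> : Num.sqrt (r ^+ 2 + w ^+ 2) = k.
  by rewrite rE wE !exprMn -mulrDr cs mulr1 sqrtr_sqr ger0_norm.
pose F (v : R * R) := f (r * v.1 + w * v.2).
have mF : measurable_fun setT F by apply: (measurableT_comp mf); solve_measurable.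
have F0 v : (0 <= F v)%E by exact: f0.
transitivity (\int[std_normal]_y \int[std_normal]_t F (y, t))%E.
  exact/esym/(@fubini_tonelli _ _ _ _ _ std_normal std_normal F mF F0).
rewrite -(ge0_integral_std_normal_rotation c0 cs mF F0).
apply: eq_integral => y _; rewrite -[RHS]integral_std_normal_cst.
apply: eq_integral => t _; congr f => /=.
transitivity ((c ^+ 2 + s ^+ 2) * (k * y)); first by rewrite rE wE; ring.
by rewrite cs mul1r.
Qed.

(* A rotation of [(x, t)] removes [t] from the first component. *)
Lemma planar_normal_add (p q r a b : R) : 0 <= p -> 0 <= r ->
  exists p' q' r', [/\ 0 <= p', 0 <= r', p' ^+ 2 = p ^+ 2 + a ^+ 2,
      p' * q' = p * q + a * b & q' ^+ 2 + r' ^+ 2 = q ^+ 2 + r ^+ 2 + b ^+ 2] /\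
    forall h, measurable_fun setT h -> (forall u, 0 <= h u)%E ->
    (\int[std_normal]_t planar_normal p q r (fun u => h (u.1 + a * t, u.2 + b * t)%R)
     = planar_normal p' q' r' h)%E.
Proof.
move=> p0 r0.
have [p' [c [s [p'0 c0 cs pE aE]]]] := polar_coordinates a p0.
pose q' := q * c + b * s; pose w := b * c - q * s.
exists p', q', (Num.sqrt (r ^+ 2 + w ^+ 2)).
split; first split=> //; rewrite ?sqrtr_ge0//.
- by rewrite pE aE !exprMn -mulrDr cs mulr1.
- by rewrite pE aE /q'; ring.
- rewrite sqr_sqrtr ?addr_ge0 ?sqr_ge0//.
  transitivity (r ^+ 2 + (q ^+ 2 + b ^+ 2) * (c ^+ 2 + s ^+ 2)).
    by rewrite /q' /w; ring.
  by rewrite cs; ring.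
move=> h mh h0; rewrite /planar_normal/=.
pose H (v : R * R) :=
  (\int[std_normal]_y h (p * v.1 + a * v.2, q * v.1 + r * y + b * v.2)%R)%E.
have H0 v : (0 <= H v)%E by exact: integral_ge0.
have mH : measurable_fun setT H.
  apply: (@measurable_fun_fubini_tonelli_F _ _ _ _ _ std_normal (fun v : (R * R) * R =>
    h (p * v.1.1 + a * v.1.2, q * v.1.1 + r * v.2 + b * v.1.2)%R)) => //.
  by apply: (measurableT_comp mh); solve_measurable.
transitivity (\int[std_normal]_x \int[std_normal]_t H (x, t))%E.
  exact/esym/(@fubini_tonelli _ _ _ _ _ std_normal std_normal H mH H0).
rewrite -(ge0_integral_std_normal_rotation c0 cs mH H0); apply: eq_integral => x _.
pose f y := h (p' * x, q' * x + y).
have mf : measurable_fun setT f.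
  apply: (measurableT_comp mh); apply: measurable_fun_pair => //.
  exact: measurable_funD.
rewrite -(ge0_integral_std_normal_add w r0 mf (fun y => h0 _)).
apply: eq_integral => t _; apply: eq_integral => y _; congr (h (_, _)) => /=.
  transitivity ((c ^+ 2 + s ^+ 2) * (p' * x)); first by rewrite pE aE; ring.
  by rewrite cs mul1r.
by rewrite /q' /w; ring.
Qed.

Lemma lin_forms_law n (a b : 'I_n -> R) :
  exists p q r, [/\ 0 <= p, 0 <= r, p ^+ 2 = \sum_j a j ^+ 2,
      p * q = \sum_j a j * b j & q ^+ 2 + r ^+ 2 = \sum_j b j ^+ 2] /\
    forall h, measurable_fun setT h -> (forall u, 0 <= h u)%E ->
    (\int[normal_vec R n]_t h (lin_form a t, lin_form b t) = planar_normal p q r h)%E.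
Proof.
elim: n => [|n IHn] in a b *.
  exists 0, 0, 0; split; first by split; rewrite ?big_ord0 ?expr0n ?mul0r ?addr0.
  move=> h mh h0; rewrite integral_dirac//; last first.
    apply: (measurableT_comp mh).
    by apply: measurable_fun_pair; exact: measurable_lin_form.
  rewrite diracT mul1e /lin_form !big_ord0 /planar_normal.
  under eq_integral do
    (under eq_integral do rewrite !mul0r addr0; rewrite integral_std_normal_cst).
  by rewrite integral_std_normal_cst.
pose wid j := widen_ord (leqnSn n) j.
have [p [q [r [[p0 r0 pE pqE qrE] lawE]]]] := IHn (a \o wid) (b \o wid).
have [p' [q' [r' [[p'0 r'0 p'E pq'E qr'E] addE]]]] :=
  planar_normal_add q (a ord_max) (b ord_max) p0 r0.
exists p', q', r'; split; first split=> //.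
- by rewrite p'E pE big_ord_recr.
- by rewrite pq'E pqE big_ord_recr.
- by rewrite qr'E qrE big_ord_recr.
move=> h mh h0; rewrite -addE// ge0_integral_normal_vecS//; last first.
  apply: (measurableT_comp mh).
  by apply: measurable_fun_pair; exact: measurable_lin_form.
apply: eq_integral => x _; rewrite -lawE//.
  by apply: eq_integral => t _; rewrite !lin_form_append.
by apply: (measurableT_comp mh); solve_measurable.
Qed.

Lemma ge0_integral_lin_form n (a : 'I_n -> R) (f : R -> \bar R) :
  measurable_fun setT f -> (forall x, 0 <= f x)%E ->
  (\int[normal_vec R n]_t f (lin_form a t)
   = \int[std_normal]_x f (Num.sqrt (\sum_j a j ^+ 2) * x)%R)%E.
Proof.
move=> mf f0; have [p [q [r [[p0 _ pE _ _] lawE]]]] := lin_forms_law a a.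
rewrite (lawE (fun u => f u.1))//; last exact: (measurableT_comp mf).
rewrite -pE sqrtr_sqr ger0_norm//; apply: eq_integral => x _.
exact: (integral_std_normal_cst (f (p * x)%R)).
Qed.

Lemma lin_form_second_moment n (a : 'I_n -> R) :
  (\int[normal_vec R n]_t (lin_form a t ^+ 2)%:E = (\sum_j a j ^+ 2)%:E)%E.
Proof.
rewrite (@ge0_integral_lin_form _ _ (fun x => (x ^+ 2)%:E)); last 2 first.
- by solve_measurable.
- by move=> x; rewrite lee_fin sqr_ge0.
have a2_ge0 : 0 <= \sum_j a j ^+ 2 by apply: sumr_ge0 => j _; exact: sqr_ge0.
under eq_integral do rewrite exprMn sqr_sqrtr// EFinM.
rewrite ge0_integralZl//.
- by rewrite [X in (_ * X)%E]std_normal_second_moment mule1.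
- by solve_measurable.
- by move=> x _; rewrite lee_fin sqr_ge0.
Qed.

Lemma lin_form_fourth_moment_le n (a : 'I_n -> R) :
  (\int[normal_vec R n]_t (lin_form a t ^+ 4)%:E
   <= (128 * (\sum_j a j ^+ 2) ^+ 2)%:E)%E.
Proof.
set v := \sum_j _; have v0 : 0 <= v by apply: sumr_ge0 => j _; exact: sqr_ge0.
rewrite (@ge0_integral_lin_form _ _ (fun x => (x ^+ 4)%:E)); last 2 first.
- by solve_measurable.
- by move=> x; rewrite lee_fin exprn_even_ge0.
rewrite (_ : 128 * v ^+ 2 = 2 * (64 * v ^+ 2)); last by ring.
apply: ge0_std_normal_le_expR_sqr4; first by solve_measurable.
  by move=> x; rewrite exprn_even_ge0.
move=> x; rewrite exprMn (exprM (Num.sqrt v) 2 2) sqr_sqrtr//.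
rewrite [leRHS]mulrAC [leRHS]mulrC.
apply: ler_wpM2l; first exact: sqr_ge0.
have : (x ^+ 2 / 4) ^+ 2 <= 4 * expR (x ^+ 2 / 4).
  by apply: sqr_le_expR; rewrite divr_ge0// sqr_ge0.
by lra.
Qed.

Lemma unit_lin_forms_law n (a b : 'I_n -> R) :
  \sum_j a j ^+ 2 = 1 -> \sum_j b j ^+ 2 = 1 ->
  exists2 r, 0 <= r /\ (\sum_j a j * b j) ^+ 2 + r ^+ 2 = 1 &
    forall h, measurable_fun setT h ->
    (\int[normal_vec R n]_t h (lin_form a t, lin_form b t)
     = \int[std_normal \x std_normal]_v
         h (v.1, (\sum_j a j * b j) * v.1 + r * v.2)%R)%E.
Proof.
move=> a1 b1; have [p [q [r [[p0 r0 pE pqE qrE] lawE]]]] := lin_forms_law a b.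
have p1 : p = 1 by apply/eqP; rewrite -sqrp_eq1// pE a1.
rewrite -pqE p1 mul1r; exists r; first by rewrite qrE b1.
apply: (@eq_integral_ge0 R _ _ _ _ _ (R * R)%type
  (normal_vec R n) (std_normal \x std_normal)%E
  (fun t => (lin_form a t, lin_form b t)) (fun v => (v.1, q * v.1 + r * v.2))).
move=> h mh h0; rewrite fubini_tonelli1//.
  rewrite (lawE h mh h0); apply: eq_integral => x _; apply: eq_integral => y _.
  by rewrite p1 mul1r.
by apply: (measurableT_comp mh); solve_measurable.
Qed.

End linear_forms.

(** * Even centered scores of correlated normals *)

Record even_score (R : realType) (M t : R) (g : R -> R) : Prop := EvenScore {
  score_measurable : measurable_fun setT g;
  score_even : forall x, g (- x) = g x;
  score_mean0 : (\int[std_normal]_x (g x)%:E = 0)%E;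
  score_growth : forall x, `|g x| <= M * expR (x ^+ 2 / 16);
  score_support : forall x, `|x| < t -> g x = 0 }.

Section even_score.
Variables (R : realType) (M t : R) (g : R -> R).
Hypotheses (t0 : 0 <= t) (gP : even_score M t g).
Local Notation tail := (expR (- t ^+ 2 / 8)).
Local Notation prod_normal := (std_normal \x std_normal)%E.
Let mg : measurable_fun setT g := score_measurable gP.

Lemma score_scale_ge0 : 0 <= M.
Proof.
have := le_trans (normr_ge0 _) (score_growth gP 0).
by rewrite pmulr_lge0// expR_gt0.
Qed.

Lemma score_tail x : `|g x| * expR (x ^+ 2 / 16) <= M * tail * expR (x ^+ 2 / 4).
Proof.
have M0 := score_scale_ge0; have [x_lt|x_ge] := ltP `|x| t.
  by rewrite (score_support gP x_lt) normr0 mul0r !mulr_ge0 ?expR_ge0.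
apply: (@le_trans _ _ (M * expR (x ^+ 2 / 16) * expR (x ^+ 2 / 16))).
  by apply: ler_wpM2r (score_growth gP x); exact: expR_ge0.
rewrite -!mulrA; apply: ler_wpM2l => //; rewrite -!expRD ler_expR.
have : t ^+ 2 <= `|x| ^+ 2 by apply: lerXn2r; rewrite ?nnegrE.
by rewrite real_normK ?num_real//; lra.
Qed.

Lemma score_sqr_tail x : g x ^+ 2 <= M ^+ 2 * tail * expR (x ^+ 2 / 4).
Proof.
rewrite -[leLHS]real_normK ?num_real// expr2.
apply: (@le_trans _ _ (`|g x| * (M * expR (x ^+ 2 / 16)))).
  by apply: ler_wpM2l => //; exact: (score_growth gP).
rewrite mulrCA [leRHS](_ : _ = M * (M * tail * expR (x ^+ 2 / 4))); last by ring.
by apply: ler_wpM2l (score_tail x); exact: score_scale_ge0.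
Qed.

Lemma score_second_moment_le :
  (\int[std_normal]_x (g x ^+ 2)%:E <= (2 * (M ^+ 2 * tail))%:E)%E.
Proof.
apply: ge0_std_normal_le_expR_sqr4; first by solve_measurable.
- by move=> x; exact: sqr_ge0.
- exact: score_sqr_tail.
Qed.

Lemma score_integrable : (std_normal : probability _ R).-integrable setT (EFin \o g).
Proof.
apply: (std_normal_integrable_le_expR_sqr4 (C := M)) => // x.
apply: (le_trans (score_growth gP x)); apply: ler_wpM2l; first exact: score_scale_ge0.
by rewrite ler_expR; have := sqr_ge0 x; lra.
Qed.

Lemma id_score_integrable :
  (std_normal : probability _ R).-integrable setT (EFin \o (fun x => x * g x)).
Proof.
have M0 := score_scale_ge0.
apply: (std_normal_integrable_le_expR_sqr4 (C := 8 * M)) => [|x].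
  by solve_measurable.
have x_le : `|x| <= 8 * expR (x ^+ 2 / 16).
  have := expR_ge1Dx (x ^+ 2 / 16); have := real_normK (num_real x).
  by have := sqr_ge0 (`|x| - 1); lra.
rewrite normrM; apply: (le_trans (ler_pM _ _ x_le (score_growth gP x))) => //.
rewrite mulrACA; apply: ler_wpM2l; first exact: mulr_ge0.
by rewrite -expRD ler_expR; have := sqr_ge0 x; lra.
Qed.

Let affine_scoreE k : EFin \o (fun u => g u * (1 + k * u))
  = ((EFin \o g) \+ (fun u => k%:E * (EFin \o (fun x => x * g x)%R) u))%E.
Proof. by apply/funext => u; rewrite /= -EFinM -EFinD; congr EFin; ring. Qed.

Lemma affine_score_integrable k :
  (std_normal : probability _ R).-integrable setT
    (EFin \o (fun u => g u * (1 + k * u))).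
Proof.
rewrite affine_scoreE; apply: integrableD => //; first exact: score_integrable.
exact: integrableZl id_score_integrable.
Qed.

Lemma affine_score_mean0 k : (\int[std_normal]_u (g u * (1 + k * u))%:E = 0)%E.
Proof.
transitivity (\int[std_normal]_u ((EFin \o g) \+
    (fun u => k%:E * (EFin \o (fun x => x * g x)%R) u)) u)%E.
  by rewrite -affine_scoreE.
rewrite integralD//; last 2 first.
- exact: score_integrable.
- exact: integrableZl id_score_integrable.
rewrite [X in (X + _)%E](score_mean0 gP) add0e integralZl//; last first.
  exact: id_score_integrable.
rewrite integral_std_normal_odd ?mule0//; first exact: id_score_integrable.
by move=> x; rewrite (score_even gP) mulNr.
Qed.

(* The kernel may be recentered by [1 + rho x u], against which [g] integrates
   to zero because it is even and centered; the remainder is O(rho^2). *)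
Section mehler_smoothing.
Variables rho r x : R.
Hypotheses (rho_small : `|rho| <= 1 / 32) (r_gt0 : 0 < r).
Hypothesis rr : rho ^+ 2 + r ^+ 2 = 1.
Local Notation kernel := (mehler rho r x).
Let recentered u := g u * (kernel u - 1 - rho * (x * u)).
Let gain := 2 ^+ 13 * rho ^+ 2 * expR (x ^+ 2 / 16).

Let score_kernelE : EFin \o (fun u => g u * kernel u)
  = ((EFin \o recentered) \+ (EFin \o (fun u => g u * (1 + (rho * x) * u))%R))%E.
Proof. by apply/funext => u; rewrite /= -EFinD /recentered; congr EFin; ring. Qed.

Let measurable_recentered : measurable_fun setT recentered.
Proof.
have mK : measurable_fun setT kernel by rewrite /mehler; solve_measurable.
by rewrite /recentered; solve_measurable.
Qed.

Let recentered_le u : `|recentered u| <= gain * (M * tail) * expR (u ^+ 2 / 4).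
Proof.
have gain_ge0 : 0 <= gain.
  by rewrite mulr_ge0 ?expR_ge0// mulr_ge0 ?sqr_ge0// exprn_ge0.
rewrite normrM; apply: (@le_trans _ _ (`|g u| * (gain * expR (u ^+ 2 / 16)))).
  by apply: ler_wpM2l => //; rewrite /gain -[leRHS]mulrA; exact: mehler_approx.
by rewrite mulrCA -[leRHS]mulrA; apply: ler_wpM2l => //; exact: score_tail.
Qed.

Let recentered_integrable :
  (std_normal : probability _ R).-integrable setT (EFin \o recentered).
Proof.
exact: std_normal_integrable_le_expR_sqr4 measurable_recentered recentered_le.
Qed.

Lemma score_mehler_integrable :
  (std_normal : probability _ R).-integrable setT (EFin \o (fun u => g u * kernel u)).
Proof.
rewrite score_kernelE.
exact: integrableD _ recentered_integrable (affine_score_integrable _).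
Qed.

Lemma score_mehler_le : (`|\int[std_normal]_u (g u * kernel u)%:E|
  <= (2 ^+ 14 * rho ^+ 2 * (M * tail) * expR (x ^+ 2 / 16))%:E)%E.
Proof.
have -> : (\int[std_normal]_u (g u * kernel u)%:E
    = \int[std_normal]_u (recentered u)%:E)%E.
  rewrite -[LHS]/(\int[std_normal]_u (EFin \o (fun u => g u * kernel u)%R) u)%E.
  rewrite score_kernelE integralD//; last exact: affine_score_integrable.
  by rewrite [X in (_ + X)%E]affine_score_mean0 adde0.
apply: (le_trans (le_abse_integral _ _ _)) => //; first exact/measurable_EFinP.
rewrite (_ : 2 ^+ 14 * _ * _ * _ = 2 * (gain * (M * tail))); last first.
  by rewrite /gain; ring.
apply: (ge0_std_normal_le_expR_sqr4 (f := fun u => `|recentered u|)) => //.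
exact: measurableT_comp.
Qed.

End mehler_smoothing.

Lemma ge0_integral_prod_normal1 (f : R -> R) : measurable_fun setT f ->
  (forall x, 0 <= f x) ->
  (\int[prod_normal]_v (f v.1)%:E = \int[std_normal]_x (f x)%:E)%E.
Proof.
move=> mf f0; have mf1 : measurable_fun setT (fun v : R * R => (f v.1)%:E).
  by apply/measurable_EFinP; exact: measurableT_comp.
apply: etrans.
  exact: (@fubini_tonelli1 _ _ _ _ _ std_normal std_normal _ mf1 (fun v => f0 _)).
by apply: eq_integral => x _; exact: (integral_std_normal_cst (f x)%:E).
Qed.

Lemma ge0_integral_prod_normal2 (rho r : R) (f : R -> R) : 0 <= r ->
  rho ^+ 2 + r ^+ 2 = 1 -> measurable_fun setT f -> (forall x, 0 <= f x) ->
  (\int[prod_normal]_v (f (rho * v.1 + r * v.2))%:E = \int[std_normal]_x (f x)%:E)%E.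
Proof.
move=> r0 rr mf f0; have rr' : r ^+ 2 + rho ^+ 2 = 1 by rewrite addrC.
have mf2 : measurable_fun setT (fun v : R * R => (f v.2)%:E).
  by apply/measurable_EFinP; exact: measurableT_comp.
have mfrot : measurable_fun setT (fun v : R * R => (f (rho * v.1 + r * v.2))%:E).
  by apply/measurable_EFinP; apply: (measurableT_comp mf); solve_measurable.
apply: etrans.
  exact: (@fubini_tonelli1 _ _ _ _ _ std_normal std_normal _ mfrot (fun v => f0 _)).
apply: (etrans (ge0_integral_std_normal_rotation r0 rr' mf2 (fun v => f0 _))).
exact: (integral_std_normal_cst (\int[std_normal]_y (f y)%:E)%E).
Qed.

Section correlated_pair.
Variables rho r : R.
Hypotheses (r0 : 0 <= r) (rr : rho ^+ 2 + r ^+ 2 = 1).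
Local Notation pair_score := (fun v : R * R => g v.1 * g (rho * v.1 + r * v.2)).

Let measurable_pair_score : measurable_fun setT pair_score.
Proof.
apply: measurable_funM; first exact: measurableT_comp.
by apply: (measurableT_comp mg); solve_measurable.
Qed.

Lemma pair_score_abs_le :
  (\int[prod_normal]_v `|pair_score v|%:E <= (2 * (M ^+ 2 * tail))%:E)%E.
Proof.
pose g2 x := 1 / 2 * g x ^+ 2.
have mg2 : measurable_fun setT g2 by rewrite /g2; solve_measurable.
have g2_ge0 x : 0 <= g2 x by rewrite mulr_ge0 ?sqr_ge0.
have m1 : measurable_fun setT (fun v : R * R => g2 v.1) by exact: measurableT_comp.
have m2 : measurable_fun setT (fun v : R * R => g2 (rho * v.1 + r * v.2)).
  by apply: (measurableT_comp mg2); solve_measurable.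
apply: (ge0_integral_le_trans (m := prod_normal)
  (g := fun v => g2 v.1 + g2 (rho * v.1 + r * v.2))) => //.
- exact: measurableT_comp.
- exact: measurable_funD.
- move=> v; rewrite ler_norml /g2.
  have := sqr_ge0 (g v.1 - g (rho * v.1 + r * v.2)).
  have := sqr_ge0 (g v.1 + g (rho * v.1 + r * v.2)).
  by move=> *; apply/andP; split; lra.
have g2_le : (\int[std_normal]_x (g2 x)%:E <= (M ^+ 2 * tail)%:E)%E.
  rewrite (_ : M ^+ 2 * tail = 1 / 2 * (2 * (M ^+ 2 * tail))); last by field.
  apply: ge0_integral_leZ score_second_moment_le; [by []|by solve_measurable|].
  by move=> x; exact: sqr_ge0.
rewrite (_ : 2 * _ = M ^+ 2 * tail + M ^+ 2 * tail); last by ring.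
apply: ge0_integral_leD => //.
- by rewrite ge0_integral_prod_normal1.
- by rewrite ge0_integral_prod_normal2.
Qed.

Lemma pair_score_integrable : prod_normal.-integrable setT (EFin \o pair_score).
Proof.
apply/integrableP; split; first by apply/measurable_EFinP; exact: measurable_pair_score.
exact: le_lt_trans pair_score_abs_le (ltry _).
Qed.

Lemma pair_score_small : `|rho| <= 1 / 32 ->
  (`|\int[prod_normal]_v (pair_score v)%:E|
   <= (2 ^+ 15 * rho ^+ 2 * (M ^+ 2 * tail))%:E)%E.
Proof.
move=> rho_small.
have r_gt0 : 0 < r.
  rewrite lt_def r0 andbT; apply/eqP => rE.
  have : `|rho| ^+ 2 = 1 by move: rr; rewrite rE expr0n addr0 real_normK ?num_real.
  by have := normr_ge0 rho; nra.
rewrite -(integral12_prod_meas1 pair_score_integrable).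
have tail_le1 : tail <= 1.
  by rewrite -[leRHS]expR0 ler_expR mulNr oppr_le0 divr_ge0 ?sqr_ge0.
have MT0 : 0 <= M * tail by rewrite mulr_ge0 ?expR_ge0 ?score_scale_ge0.
set c := 2 ^+ 14 * rho ^+ 2 * (M * tail).
have c0 : 0 <= c by rewrite mulr_ge0// mulr_ge0 ?sqr_ge0// exprn_ge0.
have inner_le x : (`|\int[std_normal]_y (g x * g (rho * x + r * y))%:E|
    <= (`|g x| * (c * expR (x ^+ 2 / 16)))%:E)%E.
  rewrite (integral_mehler (f := fun u => (g x * g u)%:E) x r_gt0 rr); last first.
    by solve_measurable.
  under eq_integral do rewrite -EFinM -mulrA EFinM.
  rewrite integralZl//; last exact: score_mehler_integrable.
  by rewrite abseM EFinM; apply: lee_pmul => //; exact: score_mehler_le.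
apply: (le_trans (le_abse_integral _ _ _)) => //.
  exact: measurable_fubini_F pair_score_integrable.
apply: (@le_trans _ _ (\int[std_normal]_x (`|g x| * (c * expR (x ^+ 2 / 16)))%:E)%E).
  apply: ge0_le_integral => //.
  - by apply: measurableT_comp => //; exact: measurable_fubini_F pair_score_integrable.
  - by apply/measurable_EFinP; apply: measurable_funM;
      [exact: measurableT_comp|solve_measurable].
  - by move=> x _; exact: inner_le.
apply: (le_trans (ge0_std_normal_le_expR_sqr4 (C := c * (M * tail)) _ _ _)).
- by apply: measurable_funM; [exact: measurableT_comp|solve_measurable].
- by move=> x; rewrite mulr_ge0// mulr_ge0 ?expR_ge0.
- by move=> x; rewrite mulrCA -[leRHS]mulrA; apply: ler_wpM2l => //; exact: score_tail.
rewrite lee_fin /c.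
have bound_ge0 : 0 <= rho ^+ 2 * (M ^+ 2 * tail).
  by rewrite mulr_ge0 ?sqr_ge0// mulr_ge0 ?sqr_ge0 ?expR_ge0.
by have := ler_wpM2l bound_ge0 tail_le1; lra.
Qed.

Lemma pair_score_cov_le : (`|\int[prod_normal]_v (pair_score v)%:E|
   <= (2 ^+ 15 * rho ^+ 2 * (M ^+ 2 * tail))%:E)%E.
Proof.
have [|rho_large] := leP `|rho| (1 / 32); first exact: pair_score_small.
apply: (le_trans (le_abse_integral _ _ _)) => //; first exact/measurable_EFinP.
apply: (le_trans pair_score_abs_le); rewrite lee_fin; apply: ler_wpM2r.
  by rewrite mulr_ge0 ?sqr_ge0 ?expR_ge0.
have : (1 / 32) ^+ 2 <= `|rho| ^+ 2 by apply: lerXn2r; rewrite ?nnegrE// ltW.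
by rewrite real_normK ?num_real//; lra.
Qed.

End correlated_pair.

End even_score.

Lemma integral_sqr_sum (R : realType) d (T : measurableType d)
    (m : {measure set T -> \bar R}) (I : finType) (X : I -> T -> R) :
  (forall i j, m.-integrable setT (EFin \o (fun x => X i x * X j x))) ->
  (\int[m]_x ((\sum_i X i x) ^+ 2)%:E = \sum_i \sum_j \int[m]_x (X i x * X j x)%:E)%E.
Proof.
move=> intX; transitivity (\int[m]_x \sum_i \sum_j (X i x * X j x)%:E)%E.
  apply: eq_integral => x _; rewrite expr2 big_distrlr/= -sumEFin.
  by apply: eq_bigr => i _; rewrite -sumEFin.
rewrite integral_sum// => [|i]; last by apply: integrable_sum => // j _; exact: intX.
by apply: eq_bigr => i _; rewrite integral_sum// => j; exact: intX.
Qed.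

Section score_statistic.
Variables (R : realType) (n : nat) (M t : R) (g : R -> R).
Hypotheses (t0 : 0 <= t) (gP : even_score M t g).
Local Notation tail := (expR (- t ^+ 2 / 8)).
Implicit Types a b : 'I_n -> R.

Definition score_cov_const : R := 2 ^+ 15 * (M ^+ 2 * tail).

Lemma score_cov_const_ge0 : 0 <= score_cov_const.
Proof. by rewrite mulr_ge0 ?exprn_ge0// mulr_ge0 ?sqr_ge0 ?expR_ge0. Qed.

Lemma score_pair_cov a b : \sum_j a j ^+ 2 = 1 -> \sum_j b j ^+ 2 = 1 ->
  (normal_vec R n).-integrable setT
    (EFin \o (fun z => g (lin_form a z) * g (lin_form b z))) /\
  (`|\int[normal_vec R n]_z (g (lin_form a z) * g (lin_form b z))%:E|
   <= (score_cov_const * (\sum_j a j * b j) ^+ 2)%:E)%E.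
Proof.
move=> a1 b1; have [r [r0 rr] lawE] := unit_lin_forms_law a1 b1.
have mg := score_measurable gP.
have mlin c : measurable_fun setT (fun z : n.-tuple R => g (lin_form c z)).
  by apply: (measurableT_comp mg); exact: measurable_lin_form.
have mh : measurable_fun setT (fun u : R * R => (g u.1 * g u.2)%:E).
  by apply/measurable_EFinP; apply: measurable_funM; exact: measurableT_comp.
split.
  apply/integrableP; split; first by apply/measurable_EFinP; exact: measurable_funM.
  rewrite (lawE (fun u => `|(g u.1 * g u.2)%:E|)%E); last exact: measurableT_comp.
  exact: le_lt_trans (pair_score_abs_le t0 gP r0 rr) (ltry _).
rewrite (lawE (fun u => (g u.1 * g u.2)%:E) mh)/=.
by rewrite /score_cov_const mulrAC; exact: pair_score_cov_le.
Qed.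

Lemma lin_formZ (c : R) a z : lin_form (fun j => c * a j) z = c * lin_form a z.
Proof. by rewrite /lin_form mulr_sumr; apply: eq_bigr => j _; rewrite mulrA. Qed.

Variables (I : finType) (a : I -> 'I_n -> R) (w : I -> R).
Local Notation var i := (\sum_k a i k ^+ 2).
Hypothesis w_bounds : forall i, 0 <= w i <= var i.

Definition score_term i (z : n.-tuple R) : R :=
  w i * g (lin_form (a i) z / Num.sqrt (var i)).

Let unit_row i : 'I_n -> R := fun l => (Num.sqrt (var i))^-1 * a i l.

Let score_termE i z : score_term i z = w i * g (lin_form (unit_row i) z).
Proof. by rewrite /score_term lin_formZ [_^-1 * _]mulrC. Qed.

Let sd_gt0 i : w i != 0 -> 0 < Num.sqrt (var i).
Proof.
have /andP[w_ge0 w_le] := w_bounds i => w0.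
by rewrite sqrtr_gt0; apply: lt_le_trans w_le; rewrite lt_def w0.
Qed.

Let unit_row1 i : w i != 0 -> \sum_l unit_row i l ^+ 2 = 1.
Proof.
move=> /sd_gt0; rewrite sqrtr_gt0 => var_gt0.
under eq_bigr do rewrite exprMn; rewrite -mulr_sumr.
by rewrite exprVn sqr_sqrtr ?mulVf ?lt0r_neq0// ltW.
Qed.

Let weighted_gram_le i j : w i != 0 -> w j != 0 ->
  w i * w j * (\sum_l unit_row i l * unit_row j l) ^+ 2 <=
  (\sum_l a i l * a j l) ^+ 2.
Proof.
move=> /sd_gt0 si_gt0 /sd_gt0 sj_gt0.
have -> : \sum_l a i l * a j l =
    Num.sqrt (var i) * Num.sqrt (var j) * \sum_l unit_row i l * unit_row j l.
  rewrite mulr_sumr; apply: eq_bigr => l _; rewrite /unit_row; field.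
  by rewrite !lt0r_neq0.
have /andP[wi_ge0 wi_le] := w_bounds i; have /andP[wj_ge0 wj_le] := w_bounds j.
rewrite [leRHS]exprMn exprMn; apply: ler_wpM2r; first exact: sqr_ge0.
by rewrite !sqr_sqrtr ?ler_pM// ltW// -sqrtr_gt0.
Qed.

Let score_term_cov i j :
  (normal_vec R n).-integrable setT
    (EFin \o (fun z => score_term i z * score_term j z)) /\
  (\int[normal_vec R n]_z (score_term i z * score_term j z)%:E
   <= (score_cov_const * (\sum_l a i l * a j l) ^+ 2)%:E)%E.
Proof.
have termE z : score_term i z * score_term j z =
    w i * w j * (g (lin_form (unit_row i) z) * g (lin_form (unit_row j) z)).
  by rewrite !score_termE mulrACA.
have [wij0|/norP[wi0 wj0]] := boolP ((w i == 0) || (w j == 0)).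
  have term0 z : score_term i z * score_term j z = 0.
    by rewrite termE; case/orP: wij0 => /eqP ->; rewrite ?(mul0r, mulr0).
  under eq_integral do rewrite term0.
  rewrite integral0 lee_fin mulr_ge0 ?sqr_ge0 ?score_cov_const_ge0//; split=> //.
  rewrite (_ : _ \o _ = cst 0%E); first exact: integrable0.
  by apply/funext => z; rewrite /= term0.
have [int_ij cov_ij] := score_pair_cov (unit_row1 wi0) (unit_row1 wj0).
have wij_ge0 : (0 <= (w i * w j)%:E)%E.
  by rewrite lee_fin mulr_ge0//; [case/andP: (w_bounds i)|case/andP: (w_bounds j)].
split.
  rewrite (_ : _ \o _ = (fun z => (w i * w j)%:E * (EFin \o (fun z =>
      g (lin_form (unit_row i) z) * g (lin_form (unit_row j) z))%R) z)%E).
    exact: integrableZl.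
  by apply/funext => z; rewrite /= termE EFinM.
under eq_integral do rewrite termE EFinM.
rewrite integralZl//; apply: le_trans (lee_wpmul2l wij_ge0 (lee_abs _)) _.
apply: le_trans (lee_wpmul2l wij_ge0 cov_ij) _.
rewrite -EFinM lee_fin mulrCA; apply: ler_wpM2l; first exact: score_cov_const_ge0.
exact: weighted_gram_le.
Qed.

Lemma score_statistic_le :
  (\int[normal_vec R n]_z ((\sum_i score_term i z) ^+ 2)%:E
   <= (score_cov_const * \sum_i \sum_j (\sum_k a i k * a j k) ^+ 2)%:E)%E.
Proof.
rewrite integral_sqr_sum => [|i j]; last by have [] := score_term_cov i j.
rewrite mulr_sumr -sumEFin; apply: lee_sum => i _.
rewrite mulr_sumr -sumEFin; apply: lee_sum => j _.
by have [] := score_term_cov i j.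
Qed.

End score_statistic.

(** * The thresholded square *)

Lemma centered_sqr_even_score (R : realType) :
  even_score (16 : R) 0 (fun x => x ^+ 2 - 1).
Proof.
split.
- by solve_measurable.
- by move=> x; rewrite sqrrN.
- have i1 : (std_normal : probability _ R).-integrable setT (cst 1%:E).
    exact: finite_measure_integrable_cst.
  under eq_integral do rewrite EFinB.
  rewrite integralB//; last exact: std_normal_integrable_sqr.
  by rewrite [X in (X - _)%E]std_normal_second_moment integral_std_normal_cst subee.
- move=> x; have := expR_ge1Dx (x ^+ 2 / 16); have := sqr_ge0 x.
  by rewrite ler_norml => *; apply/andP; split; lra.
- by move=> x; rewrite normr_lt0.
Qed.

Section truncated_second_moment.
Variables (R : realType) (t : R).
Hypothesis t_ge1 : 1 <= t.
Local Notation gauss := (std_normal : probability _ R).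
Local Notation mu := (@lebesgue_measure R).
Local Notation tail_set := [set x : R | t <= `|x|].

Let t_ge0 : 0 <= t. Proof. exact: le_trans t_ge1. Qed.

Let measurable_tail_set : measurable tail_set.
Proof.
rewrite (_ : tail_set = (fun x : R => `|x|) @^-1` `[t, +oo[).
  by rewrite -[X in measurable X]setTI; exact: normr_measurable.
by apply/seteqP; split=> x /=; rewrite in_itv/= andbT.
Qed.

Lemma normal_peak1_ge : 1 / 3 <= normal_peak (1 : R).
Proof.
rewrite /normal_peak expr1n !mul1r lef_pV2 ?posrE//; last first.
  by rewrite sqrtr_gt0 mulrn_wgt0// pi_gt0.
rewrite -[leRHS]ger0_norm// -sqrtr_sqr ler_sqrt ?sqr_ge0//.
by have := pihalf_lt2 R; rewrite -mulr_natr; lra.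
Qed.

Lemma std_normal_tail_ge :
  ((1 / 3 * expR (- (2 * t ^+ 2)))%:E <= gauss tail_set)%E.
Proof.
apply: (@le_trans _ _ (gauss `[t, 2 * t]%classic)); last first.
  apply: le_measure; rewrite ?inE//= => x /=; rewrite in_itv/= => /andP[tx _].
  exact: le_trans tx (ler_norm _).
apply: (@le_trans _ _ (\int[mu]_(x in `[t, (2 * t)%R]) (std_pdf (2 * t)%R)%:E)%E);
    last first.
  apply: ge0_le_integral => //=.
  - by move=> x _; rewrite lee_fin std_pdf_ge0.
  - by apply/measurable_funTS; solve_measurable.
  - move=> x; rewrite in_itv/= => /andP[tx x2t]; rewrite lee_fin !std_pdfE.
    by apply: ler_wpM2l; [exact: normal_peak_ge0|rewrite ler_expR; have := t_ge0; nra].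
have t_lt : t < 2 * t by have := t_ge1; lra.
rewrite integral_cst//= lebesgue_measure_itv/= lte_fin t_lt -EFinD -EFinM lee_fin.
rewrite std_pdfE (_ : - (2 * t) ^+ 2 / 2 = - (2 * t ^+ 2)); last by field.
rewrite (_ : 2 * t - t = t); last by ring.
apply: (@le_trans _ _ (normal_peak 1 * expR (- (2 * t ^+ 2)))).
  by apply: ler_wpM2r normal_peak1_ge; exact: expR_ge0.
by apply: ler_peMr => //; rewrite mulr_ge0 ?expR_ge0 ?normal_peak_ge0.
Qed.

(* Beyond [4 t] the square is dominated by [expR (x^2 / 4)] with the spare factor
   [expR (- (2 t^2))], which is the order of the tail probability. *)
Lemma tail_sqr_le (x : R) :
  x ^+ 2 <= 16 * t ^+ 2 + 8 * expR (- (2 * t ^+ 2)) * expR (x ^+ 2 / 4).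
Proof.
have norm2 : `|x| ^+ 2 = x ^+ 2 := real_normK (num_real x).
have [x_le|x_gt] := leP `|x| (4 * t).
  have : x ^+ 2 <= (4 * t) ^+ 2.
    by rewrite -norm2; apply: lerXn2r => //; rewrite nnegrE mulr_ge0.
  have : 0 <= 8 * expR (- (2 * t ^+ 2)) * expR (x ^+ 2 / 4).
    by rewrite !mulr_ge0 ?expR_ge0.
  by lra.
have : expR (x ^+ 2 / 8) <= expR (- (2 * t ^+ 2)) * expR (x ^+ 2 / 4).
  have : (4 * t) ^+ 2 <= `|x| ^+ 2.
    by apply: lerXn2r (ltW x_gt); rewrite nnegrE ?mulr_ge0.
  by rewrite norm2 -expRD ler_expR; lra.
by have := ger_expR (x ^+ 2 / 8); have := sqr_ge0 t; lra.
Qed.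

Lemma std_normal_tail_sqr_le :
  (\int[gauss]_(x in tail_set) (x ^+ 2)%:E <= (64 * t ^+ 2)%:E * gauss tail_set)%E.
Proof.
have mexp : measurable_fun tail_set (fun x : R => (expR (x ^+ 2 / 4))%:E).
  by apply: measurable_funTS; solve_measurable.
set e := expR (- (2 * t ^+ 2)); have e0 : 0 <= e := expR_ge0 _.
apply: (@le_trans _ _ (\int[gauss]_(x in tail_set)
    ((16 * t ^+ 2)%:E + (8 * e)%:E * (expR (x ^+ 2 / 4))%:E))%E).
  apply: ge0_le_integral => //=.
  - by move=> x _; rewrite lee_fin sqr_ge0.
  - by apply: measurable_funTS; solve_measurable.
  - by apply: emeasurable_funD => //; exact: measurable_funeM.
  - by move=> x _; rewrite -EFinM -EFinD lee_fin; exact: tail_sqr_le.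
rewrite ge0_integralD//; last 3 first.
- by move=> x _; rewrite lee_fin mulr_ge0 ?sqr_ge0.
- by move=> x _; rewrite -EFinM lee_fin !mulr_ge0 ?expR_ge0.
- exact: measurable_funeM.
rewrite integral_cst// ge0_integralZl//; last by rewrite lee_fin mulr_ge0.
apply: (@le_trans _ _ ((16 * t ^+ 2)%:E * gauss tail_set + (8 * e)%:E * 2%:E)%E).
  apply: leeD => //; apply: lee_wpmul2l; first by rewrite lee_fin mulr_ge0.
  exact: integral_expR_sqr4_le.
have := std_normal_tail_ge; rewrite -/e.
rewrite -(fineK (fin_num_measure gauss _ measurable_tail_set)).
set p := fine _; rewrite -!EFinM -EFinD !lee_fin => p_ge.
have p0 : 0 <= p by apply: fine_ge0; exact: measure_ge0.
have t2_ge1 : 1 <= t ^+ 2 by rewrite exprn_ege1.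
by have := ler_wpM2r p0 t2_ge1; lra.
Qed.

Let p := fine (gauss tail_set).
Let m2 := fine (\int[gauss]_(x in tail_set) (x ^+ 2)%:E)%E.

Let tail_probE : gauss tail_set = p%:E.
Proof. by rewrite fineK// fin_num_measure. Qed.

Let tail_prob_gt0 : 0 < p.
Proof.
rewrite -lte_fin -tail_probE; apply: lt_le_trans std_normal_tail_ge.
by rewrite lte_fin mulr_gt0 ?expR_gt0.
Qed.

Let tail_sqrE : (\int[gauss]_(x in tail_set) (x ^+ 2)%:E = m2%:E)%E.
Proof.
rewrite fineK// ge0_fin_numE; last first.
  by apply: integral_ge0 => x _; rewrite lee_fin sqr_ge0.
by apply: le_lt_trans std_normal_tail_sqr_le _; rewrite tail_probE -EFinM ltry.
Qed.

Let betaE : beta t = m2 / p. Proof. by []. Qed.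

Lemma beta_bounds : 0 <= beta t <= 64 * t ^+ 2.
Proof.
have m2_ge0 : 0 <= m2.
  by rewrite -lee_fin -tail_sqrE; apply: integral_ge0 => x _; rewrite lee_fin sqr_ge0.
rewrite betaE divr_ge0 ?(ltW tail_prob_gt0)//= ler_pdivrMr//.
by rewrite -lee_fin -tail_sqrE EFinM -tail_probE; exact: std_normal_tail_sqr_le.
Qed.

Definition threshold_score (x : R) : R :=
  (x ^+ 2 - beta t) * (if t < `|x| then 1 else 0).

Let measurable_threshold_score : measurable_fun setT threshold_score.
Proof. by apply: measurable_fun_indic_gt; solve_measurable. Qed.

Lemma integral_tail_set_centered :
  (\int[gauss]_(x in tail_set) (x ^+ 2 - beta t)%:E = 0)%E.
Proof.
have isqr : gauss.-integrable tail_set (fun x : R => (x ^+ 2)%:E).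
  by apply: integrableS (std_normal_integrable_sqr R).
have icst : gauss.-integrable tail_set (cst (beta t)%:E).
  exact: finite_measure_integrable_cst.
under eq_integral do rewrite EFinB.
rewrite integralB// integral_cst// tail_sqrE [X in (_ * X)%E]tail_probE -EFinM -EFinB.
by rewrite betaE divfK ?subrr// lt0r_neq0.
Qed.

Lemma threshold_score_mean0 : (\int[gauss]_x (threshold_score x)%:E = 0)%E.
Proof.
rewrite -integral_tail_set_centered [RHS]integral_mkcond.
apply: ae_eq_integral => //.
- by apply/measurable_EFinP; exact: measurable_threshold_score.
- apply/(measurable_restrictT _ _).1 => //; apply: measurable_funTS.
  by solve_measurable.
exists [set t; - t]; split; first exact: measurableU.
  apply: null_set_integral => //=; first exact: measurableU.
    by apply/measurable_EFinP/measurable_funTS; exact: measurable_normal_pdf.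
  apply: countable_lebesgue_measure0; apply: finite_set_countable.
  by rewrite finite_setU; split; exact: finite_set1.
move=> x /= /not_implyP[_ /eqP]; apply: contraNP => /not_orP[/eqP xt /eqP xNt].
have norm_neq : `|x| != t by rewrite eqr_norml negb_and (negbTE xt) (negbTE xNt).
rewrite patchE /threshold_score; have [t_lt|x_le] := ltP t `|x|.
  by rewrite mem_set ?mulr1//= ltW.
by rewrite memNset ?mulr0//= leNgt lt_neqAle norm_neq x_le.
Qed.

Lemma threshold_even_score : even_score (2 ^+ 10) t threshold_score.
Proof.
split; first exact: measurable_threshold_score.
- by move=> x; rewrite /threshold_score sqrrN normrN.
- exact: threshold_score_mean0.
- move=> x; have /andP[b_ge0 b_le] := beta_bounds.
  rewrite /threshold_score; case: ifPn => [tx|_]; last first.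
    by rewrite mulr0 normr0 mulr_ge0 ?exprn_ge0 ?expR_ge0.
  have t2_le : t ^+ 2 <= `|x| ^+ 2 by apply: lerXn2r (ltW tx); rewrite nnegrE.
  rewrite real_normK ?num_real// in t2_le.
  have := ger_expR (x ^+ 2 / 16); have := sqr_ge0 x.
  by rewrite mulr1 ler_norml => *; apply/andP; split; lra.
- by move=> x xt; rewrite /threshold_score ltNge (ltW xt)/= mulr0.
Qed.

End truncated_second_moment.

(** * Quadratic forms and the largest eigenvalue *)

Section cauchy_schwarz.
Variable R : rcfType.

Lemma sqr_le_mul_of_quadratic_ge0 (a b c : R) :
  (forall x, 0 <= a * x ^+ 2 + 2 * b * x + c) -> b ^+ 2 <= a * c.
Proof.
move=> quad_ge0; pose p := Poly [:: c; 2 * b; a].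
have p_ge0 x : 0 <= p.[x].
  by have := quad_ge0 x; rewrite horner_Poly/=; lra.
have := deg_le2_poly_ge0 (size_Poly [:: c; 2 * b; a]) p_ge0; rewrite !coef_Poly/=.
by lra.
Qed.

Lemma sqr_sum_mul_le (I : finType) (P : pred I) (x y : I -> R) :
  (\sum_(i | P i) x i * y i) ^+ 2 <=
  (\sum_(i | P i) x i ^+ 2) * (\sum_(i | P i) y i ^+ 2).
Proof.
apply: sqr_le_mul_of_quadratic_ge0 => k.
have -> : (\sum_(i | P i) x i ^+ 2) * k ^+ 2 + 2 * (\sum_(i | P i) x i * y i) * k
    + \sum_(i | P i) y i ^+ 2 = \sum_(i | P i) (k * x i + y i) ^+ 2.
  rewrite mulr_suml mulr_sumr mulr_suml -!big_split/=.
  by apply: eq_bigr => i _; ring.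
by apply: sumr_ge0 => i _; exact: sqr_ge0.
Qed.

Lemma sqr_sum_le_card (I : finType) (S : {set I}) (x : I -> R) :
  (\sum_(i in S) x i) ^+ 2 <= #|S|%:R * \sum_(i in S) x i ^+ 2.
Proof.
have := sqr_sum_mul_le (mem S) (cst 1) x.
under eq_bigr do rewrite mul1r; under [X in _ <= X * _]eq_bigr do rewrite expr1n.
by rewrite sumr_const.
Qed.

End cauchy_schwarz.

Section rayleigh_quotient.
Variable R : realType.

Definition bilform n (M : 'M[R]_n) (v w : 'rV[R]_n) : R :=
  (v *m M *m w^T) ord0 ord0.

Definition sqr_norm n (v : 'rV[R]_n) : R := \sum_i v ord0 i ^+ 2.

Lemma bilformE n (M : 'M[R]_n) v w :
  bilform M v w = \sum_i \sum_j v ord0 i * M i j * w ord0 j.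
Proof.
rewrite /bilform mxE exchange_big; apply: eq_bigr => j _.
by rewrite !mxE mulr_suml.
Qed.

Lemma bilform0l n (M : 'M[R]_n) w : bilform M 0 w = 0.
Proof. by rewrite /bilform !mul0mx mxE. Qed.

Lemma bilformC n (M : 'M[R]_n) v w : M^T = M -> bilform M v w = bilform M w v.
Proof.
move=> MT; rewrite /bilform -[in RHS]MT.
have -> : w *m M^T *m v^T = (v *m M *m w^T)^T by rewrite !trmx_mul trmxK mulmxA.
by rewrite [RHS]mxE.
Qed.

Lemma bilform_cauchy_schwarz n (M : 'M[R]_n) v w : M^T = M ->
  (forall u, 0 <= bilform M u u) ->
  bilform M v w ^+ 2 <= bilform M v v * bilform M w w.
Proof.
move=> MT M_ge0; apply: sqr_le_mul_of_quadratic_ge0 => x.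
have -> : bilform M v v * x ^+ 2 + 2 * bilform M v w * x + bilform M w w
    = bilform M (x *: v + w) (x *: v + w).
  transitivity (x ^+ 2 * bilform M v v + x * bilform M v w + x * bilform M w v
    + bilform M w w); first by rewrite (bilformC w v MT); ring.
  rewrite /bilform !(mulmxDl, mulmxDr, linearD, linearZ)/=.
  by rewrite -?scalemxAl -?scalemxAr !mxE; ring.
exact: M_ge0.
Qed.

Lemma sqr_norm0 n : sqr_norm (0 : 'rV[R]_n) = 0.
Proof. by rewrite /sqr_norm big1// => i _; rewrite mxE expr0n. Qed.

Lemma sqr_norm_ge0 n (v : 'rV[R]_n) : 0 <= sqr_norm v.
Proof. by apply: sumr_ge0 => i _; exact: sqr_ge0. Qed.

Lemma sqr_normE n (v : 'rV[R]_n) : sqr_norm v = (v *m v^T) ord0 ord0.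
Proof. by rewrite mxE; apply: eq_bigr => i _; rewrite mxE expr2. Qed.

Lemma sqr_norm_gt0 n (v : 'rV[R]_n) : v != 0 -> 0 < sqr_norm v.
Proof.
rewrite lt_def sqr_norm_ge0 andbT; apply: contraNneq.
move=> sum0; apply/eqP/rowP => i; rewrite mxE; apply/eqP; rewrite -sqrf_eq0.
by apply/eqP; apply: (psumr_eq0P _ sum0) => // j _; exact: sqr_ge0.
Qed.

Lemma bilform_scalarB n (M : 'M[R]_n) (l : R) v :
  bilform (l%:M - M) v v = l * sqr_norm v - bilform M v v.
Proof.
rewrite /bilform mulmxBr mulmxBl mul_mx_scalar -scalemxAl sqr_normE !mxE.
by congr (_ - _).
Qed.

Lemma bilform_bounded n (M : 'M[R]_n) :
  exists2 K : R, 0 < K & forall v, bilform M v v <= K * sqr_norm v.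
Proof.
exists (1 + \sum_i \sum_j `|M i j|).
  by rewrite ltr_pwDl// sumr_ge0// => i _; rewrite sumr_ge0.
move=> v; have v0 := sqr_norm_ge0 v.
rewrite mulrDl mul1r; apply: ler_wpDl => //.
rewrite bilformE mulr_suml; apply: ler_sum => i _.
rewrite mulr_suml; apply: ler_sum => j _.
apply: (le_trans (ler_norm _)); rewrite !normrM mulrAC mulrC; apply: ler_wpM2l => //.
have coord_le k : `|v ord0 k| ^+ 2 <= sqr_norm v.
  rewrite real_normK ?num_real// /sqr_norm (bigD1 k)//= lerDl.
  by apply: sumr_ge0 => l _; exact: sqr_ge0.
have := coord_le i; have := coord_le j.
by have := sqr_ge0 (`|v ord0 i| - `|v ord0 j|); lra.
Qed.

Lemma psd_unitmx_coercive n (N : 'M[R]_n) : N^T = N ->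
  (forall u, 0 <= bilform N u u) -> N \in unitmx ->
  exists2 K : R, 0 < K & forall w, sqr_norm w <= K * bilform N w w.
Proof.
move=> NT N_ge0 N_unit; have [K K0 inv_le] := bilform_bounded (invmx N)^T.
exists K => // w; have [->|w0] := eqVneq w 0.
  by rewrite sqr_norm0 mulr_ge0// ltW.
pose y := w *m invmx N; have yN : y *m N = w by rewrite /y mulmxKV.
have yw : bilform N y w = sqr_norm w by rewrite /bilform yN sqr_normE.
have yy : bilform N y y = bilform (invmx N)^T w w.
  by rewrite /bilform yN /y trmx_mul mulmxA.
have := bilform_cauchy_schwarz y w NT N_ge0; rewrite yw yy expr2.
move/le_trans/(_ (ler_wpM2r (N_ge0 w) (inv_le w))).
by rewrite mulrAC mulrC ler_pM2r// sqr_norm_gt0.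
Qed.

Definition rayleigh_sup n (M : 'M[R]_n) : R :=
  sup [set bilform M v v / sqr_norm v | v in [set v : 'rV[R]_n | v != 0]].

Lemma bilform_le_rayleigh_sup n (M : 'M[R]_n) v :
  bilform M v v <= rayleigh_sup M * sqr_norm v.
Proof.
have [->|v0] := eqVneq v 0; first by rewrite bilform0l sqr_norm0 mulr0.
rewrite -ler_pdivrMr ?sqr_norm_gt0//; apply: ub_le_sup; last by exists v.
have [K _ M_le] := bilform_bounded M; exists K => _ [w w0 <-].
by rewrite ler_pdivrMr ?sqr_norm_gt0.
Qed.

(* [rayleigh_sup M - M] is positive semidefinite but not coercive, hence
   singular. *)
Lemma eigenvalue_rayleigh_sup n (M : 'M[R]_n) (v : 'rV[R]_n) : M^T = M -> v != 0 ->
  eigenvalue M (rayleigh_sup M).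
Proof.
move=> MT v0; set l := rayleigh_sup M; pose N := l%:M - M.
have NT : N^T = N by rewrite /N linearB/= tr_scalar_mx MT.
have N_ge0 u : 0 <= bilform N u u.
  by rewrite bilform_scalarB subr_ge0; exact: bilform_le_rayleigh_sup.
have [N_unit|] := boolP (N \in unitmx); last first.
  rewrite -row_free_unit -kermx_eq0 => /rowV0Pn[u /sub_kermxP uN u0].
  apply/eigenvalueP; exists u => //; move/eqP: uN.
  by rewrite mulmxBr mul_mx_scalar subr_eq0 => /eqP.
have [K K0 coercive] := psd_unitmx_coercive NT N_ge0 N_unit.
suff : l <= l - K^-1 by rewrite lerBrDr gerDl leNgt invr_gt0 K0.
apply: ge_sup; first by exists (bilform M v v / sqr_norm v); exists v.
move=> _ [w w0 <-]; rewrite ler_pdivrMr ?sqr_norm_gt0// mulrBl lerBrDr addrC -lerBrDr.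
by rewrite -bilform_scalarB mulrC ler_pdivrMr// mulrC; exact: coercive.
Qed.

Lemma bilform_le_lambda_max n (M : 'M[R]_n) v : M^T = M ->
  bilform M v v <= lambda_max M * sqr_norm v.
Proof.
move=> MT; have [->|v0] := eqVneq v 0; first by rewrite bilform0l sqr_norm0 mulr0.
apply: (le_trans (bilform_le_rayleigh_sup M v)).
apply: ler_wpM2r; first exact: sqr_norm_ge0.
apply: ub_le_sup; last exact: eigenvalue_rayleigh_sup v0.
exists (rayleigh_sup M) => a /= /eigenvalueP[u ua u0].
have := bilform_le_rayleigh_sup M u; rewrite /bilform ua -scalemxAl mxE -sqr_normE.
by rewrite ler_pM2r// sqr_norm_gt0.
Qed.

End rayleigh_quotient.

(** * Variance of the signal term *)

Section signal_variance.
Variables (R : realType) (d : nat) (A : 'M[R]_d).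
Local Notation Sig := (A *m A^T).
Implicit Types theta : 'I_d -> R.

Lemma gramE i j : Sig i j = \sum_k A i k * A j k.
Proof. by rewrite mxE; apply: eq_bigr => k _; rewrite mxE. Qed.

Lemma gram_diag i : Sig i i = \sum_k A i k ^+ 2.
Proof. by rewrite gramE; apply: eq_bigr => k _; rewrite expr2. Qed.

Lemma gram_diag_ge0 i : 0 <= Sig i i.
Proof. by rewrite gram_diag; apply: sumr_ge0 => k _; exact: sqr_ge0. Qed.

Lemma gram_tr : Sig^T = Sig.
Proof. by rewrite trmx_mul trmxK. Qed.

Lemma frob_ge0 (M : 'M[R]_d) : 0 <= frob M.
Proof. exact: sqrtr_ge0. Qed.

Lemma frob_sqr (M : 'M[R]_d) : frob M ^+ 2 = \sum_i \sum_j M i j ^+ 2.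
Proof.
rewrite sqr_sqrtr//; apply: sumr_ge0 => i _; apply: sumr_ge0 => j _.
exact: sqr_ge0.
Qed.

Lemma sqnorm_ge0 theta : 0 <= sqnorm theta.
Proof. by apply: sumr_ge0 => i _; exact: sqr_ge0. Qed.

Lemma sqnorm_le_in_B2 (r : R) theta : 0 <= r -> in_B2 r theta -> sqnorm theta <= r ^+ 2.
Proof.
move=> r_ge0 theta_r; rewrite -[leLHS]sqr_sqrtr ?sqnorm_ge0//.
by rewrite lerXn2r ?nnegrE ?sqrtr_ge0.
Qed.

Lemma sum_theta_supp theta (F : 'I_d -> R) : (forall i, theta i = 0 -> F i = 0) ->
  \sum_i F i = \sum_(i in theta_supp theta) F i.
Proof.
move=> F0; rewrite [RHS]big_mkcond; apply: eq_bigr => i _; rewrite inE.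
by case: eqP => //= /F0.
Qed.

Lemma sqnorm_supp theta : sqnorm theta = \sum_(i in theta_supp theta) theta i ^+ 2.
Proof. by apply: sum_theta_supp => i ->; rewrite expr0n. Qed.

(* The variance of [\sum_i theta i * (A z) i] for a standard normal vector [z]. *)
Definition signal_var theta : R := \sum_j (\sum_i theta i * A i j) ^+ 2.

Lemma signal_var_ge0 theta : 0 <= signal_var theta.
Proof. by apply: sumr_ge0 => j _; exact: sqr_ge0. Qed.

Lemma signal_varE theta :
  signal_var theta = \sum_i \sum_j theta i * Sig i j * theta j.
Proof.
transitivity (\sum_k \sum_i \sum_j theta i * (A i k * A j k) * theta j).
  apply: eq_bigr => k _; rewrite expr2 big_distrlr/=.
  by apply: eq_bigr => i _; apply: eq_bigr => j _; ring.
rewrite exchange_big; apply: eq_bigr => i _.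
rewrite exchange_big; apply: eq_bigr => j _.
by rewrite gramE mulr_sumr mulr_suml.
Qed.

Lemma signal_var_le_frob theta : signal_var theta <= frob Sig * sqnorm theta.
Proof.
rewrite -(@ler_pXn2r _ 2) ?nnegrE ?signal_var_ge0 ?mulr_ge0 ?frob_ge0 ?sqnorm_ge0//.
have := sqr_sum_mul_le xpredT (fun p : 'I_d * 'I_d => Sig p.1 p.2)
  (fun p => theta p.1 * theta p.2).
rewrite -(pair_bigA _ (fun i j => Sig i j * (theta i * theta j))).
rewrite -(pair_bigA _ (fun i j => Sig i j ^+ 2)).
rewrite -(pair_bigA _ (fun i j => (theta i * theta j) ^+ 2))/= -frob_sqr.
have -> : \sum_i \sum_j Sig i j * (theta i * theta j) = signal_var theta.
  rewrite signal_varE.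
  by apply: eq_bigr => i _; apply: eq_bigr => j _; rewrite mulrCA mulrA.
have -> : \sum_i \sum_j (theta i * theta j) ^+ 2 = sqnorm theta ^+ 2.
  rewrite expr2 /sqnorm big_distrlr/=.
  by apply: eq_bigr => i _; apply: eq_bigr => j _; rewrite exprMn.
by rewrite exprMn.
Qed.

Lemma signal_var_le_sparsity s theta : (forall i, Sig i i <= 1) -> in_B0 s theta ->
  signal_var theta <= s%:R * sqnorm theta.
Proof.
move=> Sig1 theta_s; pose S := theta_supp theta.
apply: (@le_trans _ _ (\sum_j sqnorm theta * \sum_(i in S) A i j ^+ 2)).
  apply: ler_sum => j _; rewrite sqnorm_supp (sum_theta_supp (theta := theta)).
    exact: sqr_sum_mul_le.
  by move=> i ->; rewrite mul0r.
rewrite -mulr_sumr mulrC exchange_big/=; apply: ler_wpM2r; first exact: sqnorm_ge0.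
apply: (@le_trans _ _ (\sum_(i in S) 1)); last by rewrite sumr_const ler_nat.
by apply: ler_sum => i _; rewrite -gram_diag.
Qed.

Lemma signal_var_le_lambda_max theta :
  signal_var theta <= lambda_max Sig * sqnorm theta.
Proof.
have := bilform_le_lambda_max (\row_i theta i) gram_tr.
have -> : sqr_norm (\row_i theta i) = sqnorm theta.
  by apply: eq_bigr => i _; rewrite mxE.
rewrite bilformE signal_varE; congr (_ <= _).
by apply: eq_bigr => i _; apply: eq_bigr => j _; rewrite !mxE.
Qed.

Lemma lambda_max_gram_ge0 : (0 < d)%N -> 0 <= lambda_max Sig.
Proof.
move=> d_gt0; pose e (i : 'I_d) : R := (i == Ordinal d_gt0)%:R.
have e1 : sqnorm e = 1.
  rewrite /sqnorm (bigD1 (Ordinal d_gt0))//= /e eqxx expr1n big1 ?addr0//.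
  by move=> i /negbTE ->; rewrite expr0n.
have := signal_var_le_lambda_max e; rewrite e1 mulr1.
exact: le_trans (signal_var_ge0 _).
Qed.

Lemma psibar_gram_ge0 s : (0 < d)%N -> 0 <= psibar s Sig.
Proof. by move=> d_gt0; rewrite le_min lambda_max_gram_ge0/=. Qed.

Lemma signal_var_le_psibar s theta : (forall i, Sig i i <= 1) -> in_B0 s theta ->
  signal_var theta <= psibar s Sig * sqnorm theta.
Proof.
move=> Sig1 theta_s; rewrite /psibar minElt; case: ifP => _.
  exact: signal_var_le_lambda_max.
exact: signal_var_le_sparsity.
Qed.

Lemma signal_var_le_lambda_max_supp theta : signal_var theta <=
  sqnorm theta * lambda_max (principal_submx Sig (theta_supp theta)).
Proof.
set S := theta_supp theta; set P := principal_submx Sig S.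
have PT : P^T = P.
  apply/matrixP => i j; rewrite [LHS]mxE [LHS]mxE [RHS]mxE !gramE.
  by apply: eq_bigr => k _; rewrite mulrC.
pose v := \row_k theta (enum_val (A := mem S) k).
have := bilform_le_lambda_max v PT.
have -> : sqr_norm v = sqnorm theta.
  by rewrite sqnorm_supp big_enum_val; apply: eq_bigr => i _; rewrite mxE.
rewrite mulrC bilformE signal_varE; congr (_ <= _); apply/esym.
rewrite (sum_theta_supp (theta := theta)); last first.
  by move=> i ->; rewrite big1// => j _; rewrite !mul0r.
rewrite big_enum_val; apply: eq_bigr => k _.
rewrite [LHS](sum_theta_supp (theta := theta)); last by move=> j ->; rewrite mulr0.
by rewrite big_enum_val; apply: eq_bigr => l _; rewrite !mxE.
Qed.

End signal_variance.

(** * Risk of the quadratic functional *)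

Section quadratic_risk.
Variables (R : realType) (d s : nat) (sigma : R) (A : 'M[R]_d) (theta : 'I_d -> R).
Hypothesis Sig_le1 : forall i, (A *m A^T) i i <= 1.
Local Notation Sig := (A *m A^T).
Local Notation F := (frob Sig).
Implicit Types z : d.-tuple R.

Local Notation noise i z := (lin_form (A i) z).

Definition Qhat_error z : R :=
  Qhat s sigma Sig (Yobs theta sigma A (nth 0 z)) - sqnorm theta.

Lemma Yobs_noise z i : Yobs theta sigma A (nth 0 z) i = theta i + sigma * noise i z.
Proof.
rewrite /Yobs; congr (_ + _ * _); apply: eq_bigr => j _.
by rewrite (tnth_nth 0).
Qed.

Lemma measurable_Qhat : measurable_fun setT
  (fun z => Qhat s sigma Sig (Yobs theta sigma A (nth 0 z))).
Proof.
have mY i : measurable_fun setT (fun z => Yobs theta sigma A (nth 0 z) i).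
  rewrite (_ : (fun z => _) = (fun z => theta i + sigma * noise i z)).
    by have mnoise := measurable_lin_form (A i); solve_measurable.
  by apply/funext => z; exact: Yobs_noise.
rewrite /Qhat; case: (s%:R <= F); apply: measurable_sum => i; have mYi := mY i.
  by apply: measurable_fun_indic_gt; solve_measurable.
by solve_measurable.
Qed.

Lemma measurable_Qhat_error : measurable_fun setT Qhat_error.
Proof. by apply: measurable_funB; [exact: measurable_Qhat|exact: measurable_cst]. Qed.

Definition signal z : R := \sum_i theta i * noise i z.

Lemma signalE z : signal z = lin_form (fun j => \sum_i theta i * A i j) z.
Proof.
rewrite [RHS]/lin_form; apply/esym; under eq_bigr do rewrite mulr_suml.
rewrite exchange_big/=; apply: eq_bigr => i _; rewrite mulr_sumr.
by apply: eq_bigr => j _; rewrite mulrA.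
Qed.

Lemma measurable_signal : measurable_fun setT signal.
Proof. by rewrite (funext signalE); exact: measurable_lin_form. Qed.

Lemma signal_second_moment :
  (\int[normal_vec R d]_z (signal z ^+ 2)%:E = (signal_var A theta)%:E)%E.
Proof. by under eq_integral do rewrite signalE; rewrite lin_form_second_moment. Qed.

Lemma noise_eq0 i z : Sig i i = 0 -> noise i z = 0.
Proof.
rewrite gram_diag => Sii0; rewrite /lin_form big1// => j _.
have := psumr_eq0P (fun k _ => sqr_ge0 (A i k)) Sii0 (i := j) isT.
by move/eqP; rewrite sqrf_eq0 => /eqP ->; rewrite mul0r.
Qed.

Lemma score_statistic_frob (M t : R) (g : R -> R) (w : 'I_d -> R) : 0 <= t ->
  even_score M t g -> (forall i, 0 <= w i <= Sig i i) ->
  (\int[normal_vec R d]_z ((\sum_i score_term g A w i z) ^+ 2)%:E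
   <= (score_cov_const M t * F ^+ 2)%:E)%E.
Proof.
move=> t0 gP w_bounds; rewrite frob_sqr.
under [X in (_ <= (_ * X)%:E)%E]eq_bigr do under eq_bigr do rewrite gramE.
by apply: (score_statistic_le t0 gP) => i; rewrite -gram_diag.
Qed.

Lemma decomposed_risk_le (M t B : R) (g : R -> R) (w : 'I_d -> R)
    (rem : d.-tuple R -> R) : 0 <= t -> even_score M t g ->
  (forall i, 0 <= w i <= Sig i i) -> measurable_fun setT rem ->
  (\int[normal_vec R d]_z (rem z ^+ 2)%:E <= B%:E)%E ->
  (forall z, Qhat_error z = 2 * sigma * signal z + rem z
     + sigma ^+ 2 * \sum_i score_term g A w i z) ->
  (\int[normal_vec R d]_z (Qhat_error z ^+ 2)%:E
   <= (12 * sigma ^+ 2 * signal_var A theta + 3 * B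
       + 3 * sigma ^+ 4 * (score_cov_const M t * F ^+ 2))%:E)%E.
Proof.
move=> t0 gP w_bounds mrem rem_le errE.
pose stat z := \sum_i score_term g A w i z.
have mstat : measurable_fun setT stat.
  apply: measurable_sum => i; apply: measurable_funM => //.
  apply: (measurableT_comp (score_measurable gP)).
  by have mnoise := measurable_lin_form (A i); apply: measurable_funM.
have msignal := measurable_signal; have merr := measurable_Qhat_error.
have c1_ge0 : 0 <= 12 * sigma ^+ 2 by rewrite mulr_ge0 ?sqr_ge0.
have c3_ge0 : 0 <= 3 * sigma ^+ 4 by rewrite mulr_ge0 ?exprn_even_ge0.
have scaled_ge0 (k : R) (f : d.-tuple R -> R) z : 0 <= k -> 0 <= k * f z ^+ 2.
  by move=> k0; rewrite mulr_ge0 ?sqr_ge0.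
have scaled_le (k C : R) (f : d.-tuple R -> R) : 0 <= k -> measurable_fun setT f ->
    (\int[normal_vec R d]_z (f z ^+ 2)%:E <= C%:E)%E ->
    (\int[normal_vec R d]_z (k * f z ^+ 2)%:E <= (k * C)%:E)%E.
  move=> k0 mf; apply: ge0_integral_leZ => //; first by solve_measurable.
  by move=> z; exact: sqr_ge0.
apply: (ge0_integral_le_trans (g := fun z => 12 * sigma ^+ 2 * signal z ^+ 2
    + 3 * rem z ^+ 2 + 3 * sigma ^+ 4 * stat z ^+ 2)).
- by solve_measurable.
- by solve_measurable.
- by move=> z; exact: sqr_ge0.
- move=> z; rewrite errE -/(stat z).
  have := sqr_ge0 (2 * sigma * signal z - rem z).
  have := sqr_ge0 (2 * sigma * signal z - sigma ^+ 2 * stat z).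
  by have := sqr_ge0 (rem z - sigma ^+ 2 * stat z); lra.
apply: ge0_integral_leD; [by solve_measurable|by solve_measurable| | | |].
- by move=> z; rewrite addr_ge0 ?scaled_ge0.
- by move=> z; exact: scaled_ge0.
- apply: ge0_integral_leD; [by solve_measurable|by solve_measurable| | | |].
  + by move=> z; exact: scaled_ge0.
  + by move=> z; exact: scaled_ge0.
  + by apply: scaled_le => //; rewrite signal_second_moment.
  + exact: scaled_le.
- by apply: scaled_le => //; exact: score_statistic_frob.
Qed.

Definition risk_const : R := 2 ^+ 39.

Lemma gram_bounds i : 0 <= Sig i i <= 1.
Proof. by rewrite gram_diag_ge0 Sig_le1. Qed.

Section dense.
Hypothesis F_lt_s : F < s%:R.

Lemma Qhat_error_dense z : Qhat_error z = 2 * sigma * signal z + 0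
  + sigma ^+ 2 * \sum_i score_term (fun x => x ^+ 2 - 1) A (fun i => Sig i i) i z.
Proof.
rewrite /Qhat_error /Qhat leNgt F_lt_s/= /sqnorm -sumrB addr0 !mulr_sumr -big_split/=.
apply: eq_bigr => i _; rewrite Yobs_noise /score_term -gram_diag.
have [Sii0|Sii0] := eqVneq (Sig i i) 0; first by rewrite noise_eq0// Sii0; ring.
by rewrite exprMn exprVn sqr_sqrtr ?gram_diag_ge0//; field.
Qed.

Lemma dense_risk : (\int[normal_vec R d]_z (Qhat_error z ^+ 2)%:E
  <= (risk_const * (sigma ^+ 2 * signal_var A theta + sigma ^+ 4 * F ^+ 2))%:E)%E.
Proof.
apply: le_trans (decomposed_risk_le (B := 0) (rem := cst 0) (lexx 0)
  (centered_sqr_even_score R) _ _ _ Qhat_error_dense) _ => //.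
- by move=> i; rewrite gram_diag_ge0 lexx.
- by under eq_integral do rewrite expr0n; rewrite integral0.
rewrite lee_fin /score_cov_const expr0n oppr0 mul0r expR0 /risk_const.
have : 0 <= sigma ^+ 2 * signal_var A theta.
  by rewrite mulr_ge0 ?sqr_ge0 ?signal_var_ge0.
have : 0 <= sigma ^+ 4 * F ^+ 2 by rewrite mulr_ge0 ?sqr_ge0 ?exprn_even_ge0.
by lra.
Qed.

End dense.

Section sparse.
Hypotheses (s_gt0 : (0 < s)%N) (s_le_F : s%:R <= F) (sigma_gt0 : 0 < sigma).
Hypothesis theta_sparse : in_B0 s theta.
Local Notation log_ratio := (ln (1 + F ^+ 2 / s%:R ^+ 2)).
Local Notation t := (tau s Sig).

Let s2_gt0 : 0 < s%:R ^+ 2 :> R.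
Proof. by rewrite exprn_gt0// ltr0n. Qed.

Let ratio_ge1 : 1 <= F ^+ 2 / s%:R ^+ 2.
Proof. by rewrite ler_pdivlMr// mul1r; apply: lerXn2r; rewrite // nnegrE ?frob_ge0. Qed.

Lemma log_ratio_ge : 1 / 2 <= log_ratio.
Proof.
have r1 := ratio_ge1; rewrite -[leLHS]expRK ler_ln ?posrE ?expR_gt0//; last by lra.
apply: (@le_trans _ _ 2); last by lra.
have : expR (1 / 2) * expR (- (1 / 2)) = 1 :> R by rewrite -expRD subrr expR0.
by have := expR_ge1Dx (- (1 / 2) : R); have := expR_gt0 (1 / 2 : R); nra.
Qed.

Lemma tau_sqr : t ^+ 2 = 9 * log_ratio.
Proof.
have := log_ratio_ge => l_ge; rewrite /tau exprMn sqr_sqrtr; last by lra.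
by ring.
Qed.

Lemma tau_ge1 : 1 <= t.
Proof.
have t0 : 0 <= t by rewrite mulr_ge0 ?sqrtr_ge0.
rewrite -(@ler_pXn2r _ 2) ?nnegrE// expr1n tau_sqr.
by have := log_ratio_ge; lra.
Qed.

Lemma tau_tail_le : expR (- t ^+ 2 / 8) * F ^+ 2 <= s%:R ^+ 2.
Proof.
have r1 := ratio_ge1; have l_ge := log_ratio_ge; have s2 := s2_gt0.
apply: (@le_trans _ _ (expR (- log_ratio) * F ^+ 2)).
  by apply: ler_wpM2r; [exact: sqr_ge0|rewrite ler_expR tau_sqr; lra].
rewrite expRN lnK ?posrE; last by lra.
rewrite mulrC ler_pdivrMr; last by lra.
by rewrite mulrDr mulr1 mulrCA divff ?lt0r_neq0// mulr1 lerDr ltW.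
Qed.

Definition kept_term i z : R :=
  ((theta i + sigma * noise i z) ^+ 2 - sigma ^+ 2 * Sig i i * beta t)
  * (if sigma * Num.sqrt (Sig i i) * t < `|theta i + sigma * noise i z| then 1 else 0).

Lemma kept_term_null i z : theta i = 0 -> kept_term i z =
  sigma ^+ 2 * (Sig i i * threshold_score t (noise i z / Num.sqrt (Sig i i))).
Proof.
move=> theta0; rewrite /kept_term /threshold_score theta0 add0r.
have [Sii0|Sii0] := eqVneq (Sig i i) 0.
  by rewrite noise_eq0// Sii0 !(mulr0, mul0r, expr0n)/= subr0 mul0r.
have sd_gt0 : 0 < Num.sqrt (Sig i i) by rewrite sqrtr_gt0 lt_def Sii0 gram_diag_ge0.
have -> : (t < `|noise i z / Num.sqrt (Sig i i)|)
    = (sigma * Num.sqrt (Sig i i) * t < `|sigma * noise i z|).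
  rewrite !normrM (gtr0_norm sigma_gt0) normfV (gtr0_norm sd_gt0) -mulrA ltr_pM2l//.
  by rewrite ltr_pdivlMr// mulrC.
rewrite [RHS]mulrA [RHS]mulrA; congr (_ * _).
by rewrite !exprMn exprVn sqr_sqrtr ?gram_diag_ge0//; field.
Qed.

Definition kept_remainder i z : R :=
  kept_term i z - theta i ^+ 2 - 2 * sigma * (theta i * noise i z).

Lemma kept_remainder_le i z : `|kept_remainder i z|
  <= sigma ^+ 2 * (noise i z ^+ 2 + t ^+ 2 + beta t).
Proof.
have /andP[b_ge0 _] := beta_bounds tau_ge1; have t_ge0 := le_trans ler01 tau_ge1.
have /andP[Sii_ge0 Sii_le1] := gram_bounds i; have s2 := sqr_ge0 sigma.
rewrite /kept_remainder /kept_term; set e := noise i z.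
have e2 := sqr_ge0 e; have t2 := sqr_ge0 t.
case: ifPn => [_|]; last first.
  rewrite -leNgt => Y_le; rewrite mulr0.
  have Y2_le : (theta i + sigma * e) ^+ 2 <= sigma ^+ 2 * t ^+ 2.
    rewrite -[leLHS]real_normK ?num_real//.
    apply: (@le_trans _ _ ((sigma * Num.sqrt (Sig i i) * t) ^+ 2)).
      by apply: lerXn2r; rewrite // nnegrE !mulr_ge0 ?sqrtr_ge0 ?(ltW sigma_gt0).
    rewrite !exprMn sqr_sqrtr// mulrAC; apply: ler_piMr => //; exact: mulr_ge0.
  have -> : 0 - theta i ^+ 2 - 2 * sigma * (theta i * e) =
    sigma ^+ 2 * e ^+ 2 - (theta i + sigma * e) ^+ 2 by ring.
  have := sqr_ge0 (theta i + sigma * e); have := mulr_ge0 s2 b_ge0.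
  have := mulr_ge0 s2 e2; have := mulr_ge0 s2 t2.
  by rewrite ler_norml => *; apply/andP; split; lra.
have -> : ((theta i + sigma * e) ^+ 2 - sigma ^+ 2 * Sig i i * beta t) * 1
    - theta i ^+ 2 - 2 * sigma * (theta i * e)
    = sigma ^+ 2 * (e ^+ 2 - Sig i i * beta t).
  by ring.
rewrite normrM (ger0_norm s2); apply: ler_wpM2l => //.
have : Sig i i * beta t <= beta t by rewrite ler_piMl.
by have := mulr_ge0 Sii_ge0 b_ge0; rewrite ler_norml => *; apply/andP; split; lra.
Qed.

Definition moment_bound : R := 3 * sigma ^+ 4 * (128 + t ^+ 4 + beta t ^+ 2).

Let measurable_kept_remainder i : measurable_fun setT (kept_remainder i).
Proof.
have mnoise := measurable_lin_form (A i).
rewrite /kept_remainder; apply: measurable_funB; last by solve_measurable.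
apply: measurable_funB; last by solve_measurable.
by apply: measurable_fun_indic_gt; solve_measurable.
Qed.

Lemma kept_remainder_moment_le i :
  (\int[normal_vec R d]_z (kept_remainder i z ^+ 2)%:E <= moment_bound%:E)%E.
Proof.
have mnoise := measurable_lin_form (A i).
have mrem := @measurable_kept_remainder i.
have /andP[b_ge0 _] := beta_bounds tau_ge1.
have sigma4_ge0 : 0 <= sigma ^+ 4 by rewrite exprn_even_ge0.
have pow4_ge0 (x : R) : 0 <= x ^+ 4 by rewrite exprn_even_ge0.
apply: (ge0_integral_le_trans
  (g := fun z => 3 * sigma ^+ 4 * (noise i z ^+ 4 + (t ^+ 4 + beta t ^+ 2)))).
- by solve_measurable.
- by solve_measurable.
- by move=> z; exact: sqr_ge0.
- move=> z; have rem_le := kept_remainder_le i z.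
  rewrite -[leLHS]real_normK ?num_real//.
  apply: (le_trans (lerXn2r 2 _ _ rem_le)); rewrite ?nnegrE//.
    by rewrite mulr_ge0 ?addr_ge0 ?sqr_ge0.
  rewrite exprMn -exprM -[leRHS]mulrA [leRHS]mulrCA; apply: ler_wpM2l => //.
  rewrite (exprM (noise i z) 2 2) (exprM t 2 2).
  move: (noise i z ^+ 2) (t ^+ 2) (beta t) => x y u.
  by have := sqr_ge0 (x - y); have := sqr_ge0 (x - u); have := sqr_ge0 (y - u); lra.
rewrite /moment_bound -addrA; apply: ge0_integral_leZ.
- by rewrite mulr_ge0.
- by solve_measurable.
- by move=> z; rewrite !addr_ge0 ?sqr_ge0.
apply: ge0_integral_leD => //; first by solve_measurable.
- by move=> z; rewrite addr_ge0 ?sqr_ge0.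
- apply: (le_trans (lin_form_fourth_moment_le (A i))); rewrite -gram_diag lee_fin.
  have /andP[Sii_ge0 Sii_le1] := gram_bounds i.
  by rewrite ler_piMr// exprn_ile1.
- by rewrite integral_cst// [X in (_ * X)%E]probability_setT mule1.
Qed.

Lemma moment_bound_le : moment_bound <= 2 ^+ 20 * (sigma ^+ 4 * log_ratio ^+ 2).
Proof.
have l_ge := log_ratio_ge; have /andP[b_ge0] := beta_bounds tau_ge1.
rewrite tau_sqr => b_le; have s4 : 0 <= sigma ^+ 4 by rewrite exprn_even_ge0.
have b2_le : beta t ^+ 2 <= (64 * (9 * log_ratio)) ^+ 2.
  by apply: lerXn2r; rewrite // nnegrE; lra.
have l2_ge : 1 <= 4 * log_ratio ^+ 2 by nra.
rewrite /moment_bound (exprM t 2 2) tau_sqr [3 * _]mulrC -mulrA [leRHS]mulrCA.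
apply: ler_wpM2l => //.
by lra.
Qed.

Lemma kept_remainder_sum_le : (\int[normal_vec R d]_z
  ((\sum_(i in theta_supp theta) kept_remainder i z) ^+ 2)%:E
  <= (s%:R ^+ 2 * moment_bound)%:E)%E.
Proof.
set S := theta_supp theta.
have mB_ge0 : 0 <= moment_bound.
  apply: mulr_ge0; first by rewrite mulr_ge0// exprn_even_ge0.
  by rewrite addr_ge0 ?sqr_ge0// addr_ge0// exprn_even_ge0.
have S_le : #|S|%:R <= s%:R :> R by rewrite ler_nat.
apply: (ge0_integral_le_trans
  (g := fun z => #|S|%:R * \sum_(i <- enum S) kept_remainder i z ^+ 2)).
- under eq_fun do rewrite -big_enum; apply: measurable_funX.
  by apply: measurable_sum => i; exact: measurable_kept_remainder.
- apply: measurable_funM => //; apply: measurable_sum => i; apply: measurable_funX.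
  exact: measurable_kept_remainder.
- by move=> z; exact: sqr_ge0.
- by move=> z; rewrite big_enum; exact: sqr_sum_le_card.
apply: (@le_trans _ _ (#|S|%:R * \sum_(i <- enum S) moment_bound)%:E); last first.
  rewrite lee_fin big_enum sumr_const -[moment_bound *+ _]mulr_natl mulrA.
  by rewrite ler_wpM2r// expr2 ler_pM.
apply: ge0_integral_leZ => //.
- apply: measurable_sum => i; apply: measurable_funX; exact: measurable_kept_remainder.
- by move=> z; apply: sumr_ge0 => i _; exact: sqr_ge0.
apply: ge0_integral_le_sum => [i|i z|i].
- by apply: measurable_funX; exact: measurable_kept_remainder.
- exact: sqr_ge0.
- exact: kept_remainder_moment_le.
Qed.

Lemma Qhat_error_sparse z : Qhat_error z = 2 * sigma * signal z
  + \sum_(i in theta_supp theta) kept_remainder i z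
  + sigma ^+ 2 * \sum_i score_term (threshold_score t) A
      (fun i => if theta i == 0 then Sig i i else 0) i z.
Proof.
rewrite /Qhat_error /Qhat s_le_F /sqnorm -sumrB.
rewrite (big_mkcond (fun i => i \in _)) !mulr_sumr -!big_split/=.
apply: eq_bigr => i _; rewrite Yobs_noise -/(kept_term i z) inE /score_term -gram_diag.
have [theta0|theta0]/= := eqVneq (theta i) 0.
  by rewrite kept_term_null// theta0; ring.
by rewrite /kept_remainder; ring.
Qed.

Lemma sparse_risk : (\int[normal_vec R d]_z (Qhat_error z ^+ 2)%:E
  <= (risk_const * (sigma ^+ 2 * signal_var A theta
        + sigma ^+ 4 * (s%:R * log_ratio) ^+ 2))%:E)%E.
Proof.
apply: le_trans (decomposed_risk_le (le_trans ler01 tau_ge1)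
  (threshold_even_score tau_ge1) _ _ kept_remainder_sum_le Qhat_error_sparse) _.
- by move=> i; case: ifP => _; rewrite ?lexx gram_diag_ge0.
- under eq_fun do rewrite -big_enum.
  by apply: measurable_sum => i; exact: measurable_kept_remainder.
have V_ge0 : 0 <= sigma ^+ 2 * signal_var A theta.
  by rewrite mulr_ge0 ?sqr_ge0 ?signal_var_ge0.
have s4 : 0 <= sigma ^+ 4 by rewrite exprn_even_ge0.
have rem_le := ler_wpM2l (ltW s2_gt0) moment_bound_le.
have tail_le := ler_wpM2l s4 tau_tail_le.
have s2_le : s%:R ^+ 2 <= 4 * (s%:R * log_ratio) ^+ 2.
  rewrite exprMn mulrCA ler_peMr ?sqr_ge0//.
  by have := log_ratio_ge; nra.
have := ler_wpM2l s4 s2_le; have := mulr_ge0 s4 (sqr_ge0 (s%:R * log_ratio)).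
rewrite lee_fin /score_cov_const /risk_const !(exprMn 2 s%:R).
rewrite (_ : 2 ^+ 15 * _ * _ = 2 ^+ 35 * (expR (- t ^+ 2 / 8) * F ^+ 2)); last by ring.
move: (moment_bound) rem_le tail_le => mB.
by lra.
Qed.

End sparse.

End quadratic_risk.

(** * Risk of the norm *)

Section sqrt_plugin.
Variable R : realType.
Implicit Types a b : R.

Lemma subr_sqrtE a b : 0 <= a -> 0 <= b ->
  a - b = (Num.sqrt a - Num.sqrt b) * (Num.sqrt a + Num.sqrt b).
Proof. by move=> a0 b0; rewrite -subr_sqr !sqr_sqrtr. Qed.

Lemma normr_sqrtB_le a b : `|Num.sqrt a - Num.sqrt b| <= Num.sqrt a + Num.sqrt b.
Proof.
by rewrite (le_trans (ler_normB _ _))// !ger0_norm ?sqrtr_ge0.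
Qed.

Lemma sqr_sqrtB_le a b : 0 <= a -> 0 <= b ->
  (Num.sqrt a - Num.sqrt b) ^+ 2 <= `|a - b|.
Proof.
move=> a0 b0; rewrite -[leLHS]real_normK ?num_real// expr2 subr_sqrtE// normrM.
rewrite (ger0_norm (addr_ge0 (sqrtr_ge0 a) (sqrtr_ge0 b))).
by apply: ler_wpM2l => //; exact: normr_sqrtB_le.
Qed.

Lemma sqr_sqrtB_mul_le a b : 0 <= a -> 0 <= b ->
  b * (Num.sqrt a - Num.sqrt b) ^+ 2 <= (a - b) ^+ 2.
Proof.
move=> a0 b0; rewrite [in leRHS]subr_sqrtE// exprMn mulrC -[X in _ * X <= _]sqr_sqrtr//.
apply: ler_wpM2l; first exact: sqr_ge0.
by apply: lerXn2r; rewrite ?nnegrE ?addr_ge0 ?sqrtr_ge0// lerDr sqrtr_ge0.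
Qed.

Lemma measurable_fun_sqrt : measurable_fun setT (@Num.sqrt R).
Proof. by apply: continuous_measurable_fun; exact: sqrt_continuous. Qed.

Lemma measurable_sqrt_plugin_error d (T : measurableType d) (Q : T -> R) b :
  measurable_fun setT Q ->
  measurable_fun setT (fun x => (Num.sqrt `|Q x| - Num.sqrt b) ^+ 2).
Proof.
move=> mQ; apply: measurable_funX; apply: measurable_funB; last exact: measurable_cst.
by apply: (measurableT_comp measurable_fun_sqrt); exact: measurableT_comp.
Qed.

Lemma sqrt_plugin_risk_le d (T : measurableType d) (P : probability T R)
    (Q : T -> R) (b rate K : R) :
  measurable_fun setT Q -> 0 <= b -> 0 <= rate -> 1 <= K ->
  (\int[P]_x ((Q x - b) ^+ 2)%:E <= (K * (2 * rate * b + rate ^+ 2))%:E)%E ->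
  (\int[P]_x ((Num.sqrt `|Q x| - Num.sqrt b) ^+ 2)%:E <= (3 * K * rate)%:E)%E.
Proof.
move=> mQ b0 rate0 K1 Qrisk.
have mQb : measurable_fun setT (fun x => Q x - b) by solve_measurable.
have mroot := measurable_sqrt_plugin_error b mQ.
have dist_le x : `| `|Q x| - b| <= `|Q x - b|.
  by rewrite -{1}(ger0_norm b0) ler_dist_dist.
have [b_le|b_gt] := leP b rate.
- apply: (ge0_integral_le_trans (g := fun x => `|Q x - b|)) => //.
  + exact: measurableT_comp.
  + by move=> x; exact: sqr_ge0.
  + by move=> x; apply: le_trans (dist_le x); exact: sqr_sqrtB_le.
  apply: integral_norm_le_of_sqr => //; first by rewrite !mulr_ge0//; lra.
  apply: (le_trans Qrisk); rewrite lee_fin.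
  have : K * (rate * b) <= K * (rate * rate) by rewrite ler_wpM2l ?ler_wpM2l//; lra.
  have : K * rate ^+ 2 <= K ^+ 2 * rate ^+ 2.
    by rewrite ler_wpM2r ?sqr_ge0// expr2 ler_peMl//; lra.
  by have := mulr_ge0 (sqr_ge0 K) (sqr_ge0 rate); lra.
have b_gt0 := le_lt_trans rate0 b_gt.
have scaled_le : (\int[P]_x (b * (Num.sqrt `|Q x| - Num.sqrt b) ^+ 2)%:E
    <= (b * (3 * K * rate))%:E)%E.
  apply: (ge0_integral_le_trans (g := fun x => (Q x - b) ^+ 2)).
  - by apply: measurable_funM.
  - exact: measurable_funX.
  - by move=> x; rewrite mulr_ge0 ?sqr_ge0.
  - move=> x; apply: (le_trans (sqr_sqrtB_mul_le _ b0)) => //.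
    by rewrite -real_normK ?num_real// -[leRHS]real_normK ?num_real// lerXn2r.
  - apply: (le_trans Qrisk); rewrite lee_fin.
    have : K * (rate * rate) <= K * (rate * b).
      by rewrite !ler_wpM2l// ?ltW//; lra.
    by lra.
under eq_integral do rewrite -(mulKf (lt0r_neq0 b_gt0) (_ ^+ 2)).
rewrite -[3 * K * rate](mulKf (lt0r_neq0 b_gt0)).
apply: ge0_integral_leZ => //; first by rewrite invr_ge0.
- exact: measurable_funM.
- by move=> x; rewrite mulr_ge0 ?sqr_ge0.
Qed.

End sqrt_plugin.

Section risk.
Variables (R : realType) (d s : nat) (sigma : R) (A : 'M[R]_d) (theta : 'I_d -> R).
Local Notation Sig := (A *m A^T).
Hypotheses (s_gt0 : (0 < s)%N) (sigma_gt0 : 0 < sigma).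
Hypotheses (Sig_le1 : forall i, Sig i i <= 1) (theta_sparse : in_B0 s theta).

Lemma gauss_expect_sqr_Qhat_error :
  gauss_expect d (fun z =>
    ((Qhat s sigma Sig (Yobs theta sigma A z) - sqnorm theta) ^+ 2)%:E)
  = (\int[normal_vec R d]_z (Qhat_error s sigma A theta z ^+ 2)%:E)%E.
Proof.
apply: ge0_gauss_expectE => [z|]; first by rewrite lee_fin sqr_ge0.
by apply/measurable_EFinP/measurable_funX; exact: measurable_Qhat_error.
Qed.

Lemma quadratic_risk_le (v : R) : signal_var A theta <= v ->
  (\int[normal_vec R d]_z (Qhat_error s sigma A theta z ^+ 2)%:E
   <= (risk_const R * (sigma ^+ 2 * v + sigma ^+ 4 * psi s Sig ^+ 2))%:E)%E.
Proof.
move=> V_le; apply: (@le_trans _ _ (risk_const R * (sigma ^+ 2 * signal_var A theta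
    + sigma ^+ 4 * psi s Sig ^+ 2))%:E); last first.
  by rewrite lee_fin ler_wpM2l ?exprn_ge0// lerD2r ler_wpM2l ?sqr_ge0.
rewrite /psi; case: ifPn => [s_le_F|]; first exact: sparse_risk.
by rewrite -ltNge => F_lt_s; exact: dense_risk.
Qed.

Lemma psi_ge0 : 0 <= psi s Sig.
Proof.
rewrite /psi; case: ifPn => [s_le_F|_]; last exact: frob_ge0.
by have := log_ratio_ge s_gt0 s_le_F => l_ge; rewrite mulr_ge0//; lra.
Qed.

Lemma signal_var_le_psi : signal_var A theta <= 2 * psi s Sig * sqnorm theta.
Proof.
rewrite /psi; case: ifPn => [s_le_F|_].
  have l_ge := log_ratio_ge s_gt0 s_le_F.
  apply: (le_trans (signal_var_le_sparsity Sig_le1 theta_sparse)).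
  apply: ler_wpM2r; first exact: sqnorm_ge0.
  by rewrite mulrCA ler_peMr//; lra.
apply: (le_trans (signal_var_le_frob A theta)).
apply: ler_wpM2r; first exact: sqnorm_ge0.
by rewrite ler_peMl ?frob_ge0//; lra.
Qed.

Lemma norm_risk_le : (gauss_expect d (fun z =>
    ((Nhat s sigma Sig (Yobs theta sigma A z) - Num.sqrt (sqnorm theta)) ^+ 2)%:E)
  <= (3 * risk_const R * (sigma ^+ 2 * psi s Sig))%:E)%E.
Proof.
have mQ := measurable_Qhat s sigma A theta.
rewrite ge0_gauss_expectE => [|z|]; last 2 first.
- by rewrite lee_fin sqr_ge0.
- by apply/measurable_EFinP; exact: measurable_sqrt_plugin_error.
apply: sqrt_plugin_risk_le => //; first exact: sqnorm_ge0.
- by rewrite mulr_ge0 ?sqr_ge0 ?psi_ge0.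
- by rewrite exprn_ege1// ler1n.
apply: (le_trans (quadratic_risk_le signal_var_le_psi)).
by rewrite lee_fin le_eqVlt; apply/orP; left; apply/eqP; ring.
Qed.

End risk.

Theorem theorem1 (R : realType) :
  exists C : R, 0 < C /\
  forall (d s : nat) (sigma : R) (Sig A : 'M[R]_d),
    (1 <= d)%N -> (1 <= s <= d)%N -> 0 < sigma ->
    covariance_mx Sig -> Sig = A *m A^T ->
    (forall i, Sig i i <= 1) ->
    [/\ (forall theta : 'I_d -> R, in_B0 s theta ->
          (gauss_expect d (fun z =>
             ((Qhat s sigma Sig (Yobs theta sigma A z) - sqnorm theta) ^+ 2)%:E)
           <= (C * (sigma ^+ 2 * sqnorm theta
                      * lambda_max (principal_submx Sig (theta_supp theta))
                    + sigma ^+ 4 * psi s Sig ^+ 2))%:E)%E),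
        (forall r : R, 0 < r -> forall theta : 'I_d -> R,
          in_B0 s theta -> in_B2 r theta ->
          (gauss_expect d (fun z =>
             ((Qhat s sigma Sig (Yobs theta sigma A z) - sqnorm theta) ^+ 2)%:E)
           <= (C * (sigma ^+ 2 * r ^+ 2 * psibar s Sig
                    + sigma ^+ 4 * psi s Sig ^+ 2))%:E)%E) &
        (forall theta : 'I_d -> R, in_B0 s theta ->
          (gauss_expect d (fun z =>
             ((Nhat s sigma Sig (Yobs theta sigma A z)
               - Num.sqrt (sqnorm theta)) ^+ 2)%:E)
           <= (C * (sigma ^+ 2 * psi s Sig))%:E)%E)].
Proof.
exists (3 * risk_const R); split; first by rewrite mulr_gt0 ?exprn_gt0.
move=> d s sigma Sig A d_gt0 /andP[s_gt0 _] sigma_gt0 _ -> Sig_le1.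
have quadratic_risk theta v : in_B0 s theta -> signal_var A theta <= v ->
    (gauss_expect d (fun z => ((Qhat s sigma (A *m A^T) (Yobs theta sigma A z)
       - sqnorm theta) ^+ 2)%:E)
     <= (3 * risk_const R * (sigma ^+ 2 * v
                             + sigma ^+ 4 * psi s (A *m A^T) ^+ 2))%:E)%E.
  move=> theta_sparse V_le; rewrite gauss_expect_sqr_Qhat_error.
  apply: (le_trans (quadratic_risk_le s_gt0 sigma_gt0 Sig_le1 theta_sparse V_le)).
  have v_ge0 : 0 <= v := le_trans (signal_var_ge0 _ _) V_le.
  rewrite lee_fin -mulrA ler_peMl ?ler1n// mulr_ge0 ?exprn_ge0//.
  by rewrite addr_ge0// mulr_ge0 ?sqr_ge0 ?exprn_even_ge0.
split=> [theta theta_sparse|r r_gt0 theta theta_sparse theta_r|theta theta_sparse].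
- rewrite -(mulrA (sigma ^+ 2)); apply: quadratic_risk => //.
  exact: signal_var_le_lambda_max_supp.
- rewrite -(mulrA (sigma ^+ 2)); apply: quadratic_risk => //.
  apply: (le_trans (signal_var_le_psibar Sig_le1 theta_sparse)); rewrite mulrC.
  apply: ler_wpM2r; first exact: psibar_gram_ge0.
  exact: sqnorm_le_in_B2 (ltW r_gt0) theta_r.
- exact: norm_risk_le.
Qed.
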